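(* For each $\iota>0$ and each positive integer $k$, there is $D_0$ such that if $D\ge D_0$ and $\mathcal{H}$ is a $k$-uniform $k$-simple hypergraph with maximum degree at most $D$, then $$\chi'(\mathcal{H}) \le \left(1-\frac{k-1}{2k^2}+\frac{(k-1)(k-2)}{6k^3\sqrt{k}}+\iota\right)kD.$$
   Context: A hypergraph $\mathcal{H}$ consists of a vertex set $V(\mathcal{H})$ and a multiset $E(\mathcal{H})$ of edges, each a subset of $V(\mathcal{H})$ (repeated edges are allowed and copies count as distinct edges). It is $k$-uniform if every edge has size $k$, and $t$-simple if every two distinct edges intersect in at most $t$ vertices (so for a $k$-uniform hypergraph, being $k$-simple is no restriction). The degree of a vertex is the number of edges (with multiplicity) containing it. The chromatic index $\chi'(\mathcal{H})$ is the smallest number of colors needed to color the edges of $\mathcal{H}$ so that any two distinct intersecting edges receive distinct colors. *)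

(* Defs.v *)
From HB Require Import structures.
From mathcomp Require Import all_boot.

Set Implicit Arguments.
Unset Strict Implicit.
Unset Printing Implicit Defensive.

(* Finite hypergraphs with repeated edges: the multiset of edges is a family of
   vertex sets indexed by a finite type, so that two copies of the same vertex
   set are distinct elements of [edge H]. *)
Record hypergraph := Hypergraph {
  vertex : finType;
  edge : finType;
  edge_set : edge -> {set vertex}
}.

Definition uniform_hypergraph (k : nat) (H : hypergraph) : Prop :=
  forall e : edge H, #|edge_set e| = k.

Definition simple_hypergraph (t : nat) (H : hypergraph) : Prop :=
  forall e f : edge H, e != f -> #|edge_set e :&: edge_set f| <= t.

Definition degree (H : hypergraph) (v : vertex H) : nat :=
  #|[set e : edge H | v \in edge_set e]|.

Definition max_degree (H : hypergraph) : nat := \max_(v : vertex H) degree v.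

Definition proper_edge_coloring (H : hypergraph) (n : nat)
    (c : {ffun edge H -> 'I_n}) : bool :=
  [forall e, forall f,
    (e != f) && (edge_set e :&: edge_set f != set0) ==> (c e != c f)].

Definition edge_colorable (H : hypergraph) (n : nat) : bool :=
  [exists c : {ffun edge H -> 'I_n}, proper_edge_coloring c].

Lemma edge_colorable_exists (H : hypergraph) : exists n, edge_colorable H n.
Proof.
exists #|edge H|; apply/existsP; exists [ffun e => enum_rank e].
apply/forallP=> e; apply/forallP=> f; apply/implyP=> /andP[neq_ef _].
by rewrite !ffunE (inj_eq enum_rank_inj).
Qed.

Definition chromatic_index (H : hypergraph) : nat :=
  ex_minn (edge_colorable_exists H).

(* Main.v *)
(* Put T = k D. Give every edge f and every color c of its list an independent
   random label, and select f for c if its label is smaller than those of the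
   edges meeting f that have c in their lists, and of enough private dummy labels
   to make f selected with probability about 1 / T, the same for all f. Colors are
   treated in small batches: after a batch with l colors in each list, T has dropped by about
   l, while c survives in the list of e if no edge of the neighborhood F of e was
   selected for c, which has probability at least g = (k-1) / (2k^2+k-2). Hence
   (1 - g + o(1)) T colors suffice.

   For the bound on g: the expected number of selected edges in F is at most
   |F| / T <= 1, and the probability that none is selected exceeds 1 - |F| / T by
   the expected number of selected g in F with a smaller selected f in F. Two
   disjoint edges f, g of F realize this, with f beating all of F, with probability
   at least 1 / (T |N[e] \cup N[f] \cup N[g]|). Each vertex has degree at most D,
   so the vertices outside e cannot make all pairs in F intersect; the extremal case is a
   projective plane blown up by D / k, where every edge of F misses the same
   fraction (k-1) / k^2 of T.

   All degrees and list sizes are functions of independent colors with bounded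
   differences, so they are concentrated with exponentially small error, and the
   local lemma makes all of them behave simultaneously. *)

Require Import Defs.
From mathcomp Require Import all_boot all_order all_algebra.
From mathcomp Require Import reals.
From mathcomp Require Import all_fingroup sequences exp.
From mathcomp Require Import zify ring lra.

Set Implicit Arguments.
Unset Strict Implicit.
Unset Printing Implicit Defensive.

Import Order.TTheory GRing.Theory Num.Theory.

(** * Double counting and the union bound *)

Lemma sum_card_swap (I J : finType) (P : pred I) (Q : I -> J -> bool) :
  \sum_(i | P i) #|[set j | Q i j]| = \sum_j #|[set i | P i && Q i j]|.
Proof.
rewrite (eq_bigr (fun i => \sum_j (Q i j : nat))); last first.
  move=> i _; rewrite -sum1_card big_mkcond /=.
  by apply: eq_bigr => j _; rewrite inE; case: (Q i j).
rewrite exchange_big; apply: eq_bigr => j _.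
rewrite -sum1_card big_mkcond [RHS]big_mkcond /=.
by apply: eq_bigr => i _; rewrite inE; case: (P i); case: (Q i j).
Qed.

Lemma card_bigcup_le (I T : finType) (P : pred I) (S : I -> {set T}) :
  #|\bigcup_(i | P i) S i| <= \sum_(i | P i) #|S i|.
Proof.
elim/big_rec2: _ => [|i m B _ le_mB]; first by rewrite cards0.
by apply: leq_trans (leq_card_setU _ _) _; rewrite leq_add2l.
Qed.

(** * The symmetric local lemma *)

Section LocalLemma.
Variables (Omega I : finType) (B : I -> {set Omega}) (Gam : I -> {set I}).
Variable d : nat.

(** Events are subsets of the uniform space [Omega]: probabilities are cardinalities, and all
    conditions are stated in [nat] with denominators cleared. *)
Definition avoiding (J : {set I}) : {set Omega} := \bigcap_(j in J) ~: B j.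

Hypothesis indep : forall i (J : {set I}), [disjoint J & Gam i] ->
  #|B i :&: avoiding J| * #|Omega| = #|B i| * #|avoiding J|.
Hypothesis Gam_le : forall i, #|Gam i| <= d.
Hypothesis rare : forall i, 4 * d * #|B i| <= #|Omega|.
Hypothesis d_gt0 : 0 < d.
Hypothesis Omega_gt0 : 0 < #|Omega|.

Lemma avoidingS (J J' : {set I}) :
  J \subset J' -> avoiding J' \subset avoiding J.
Proof.
move=> sJ; apply/subsetP => w /bigcapP wJ; apply/bigcapP => j jJ.
by apply: wJ; apply: (subsetP sJ).
Qed.

(* Conditionally on avoiding [J], the event [B i] has probability at most
   [1 / (2 d)]. *)
Lemma local_lemma_step (J : {set I}) i :
  2 * d * #|B i :&: avoiding J| <= #|avoiding J|.
Proof.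
have [n] := ubnP #|J|; elim: n => // n IH in J i *; rewrite ltnS => leJn.
pose J1 := J :&: Gam i; pose J2 := J :\: Gam i.
have sub2 : J2 \subset J by apply: subsetDl.
have dis2 : [disjoint J2 & Gam i] by rewrite -setI_eq0 setIDAC setDIl setDv setI0.
have leB : #|B i :&: avoiding J| <= #|B i :&: avoiding J2|.
  by apply/subset_leq_card/setIS/avoidingS.
have B2 : 4 * d * #|B i :&: avoiding J2| <= #|avoiding J2|.
  rewrite -(leq_pmul2r Omega_gt0) -mulnA indep // mulnA [X in _ <= X]mulnC.
  by rewrite leq_mul2r rare orbT.
(* By induction each of the at most [d] events in [J1] covers at most a fraction [1 / (2 d)] of
   [avoiding J2], so together they cover at most half of it. The induction needs [J2] smaller than
   [J], hence the separate case of empty [J1]. *)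
have half : #|avoiding J2| <= 2 * #|avoiding J|.
  have [J10|/set0Pn[j0 j0J1]] := eqVneq J1 set0.
    suff -> : J2 = J by lia.
    by apply/setDidPl; rewrite -setI_eq0 -/J1 J10.
  have ltJ2 : #|J2| < n.
    apply: leq_trans leJn; apply: proper_card; apply/properP; split => //.
    move: j0J1; rewrite inE => /andP[j0J j0G].
    by exists j0 => //; rewrite inE j0G.
  have cov : avoiding J2 \subset
      avoiding J :|: \bigcup_(j in J1) (B j :&: avoiding J2).
    apply/subsetP => w wJ2; rewrite inE.
    case: (boolP (w \in avoiding J)) => //= wJ.
    have [j jJ wBj] : exists2 j, j \in J & w \in B j.
      case: (boolP [exists j in J, w \in B j]) => [/exists_inP//|].
      rewrite negb_exists_in => /forall_inP nB; case/negP: wJ.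
      by apply/bigcapP => j jJ; rewrite inE; apply: nB.
    apply/bigcupP; exists j; last by rewrite inE wBj.
    rewrite inE jJ /=; apply: contraLR wBj => jG.
    by move/bigcapP: wJ2 => /(_ j); rewrite !inE jG jJ; apply.
  have sumle : 2 * d * \sum_(j in J1) #|B j :&: avoiding J2|
      <= d * #|avoiding J2|.
    rewrite big_distrr /=.
    apply: (@leq_trans (\sum_(j in J1) #|avoiding J2|)).
      by apply: leq_sum => j _; apply: IH.
    rewrite sum_nat_const leq_mul2r; apply/orP; right.
    by apply: leq_trans (Gam_le i); apply/subset_leq_card/subsetIr.
  have := leq_trans (subset_leq_card cov) (leq_card_setU _ _).
  have : #|\bigcup_(j in J1) (B j :&: avoiding J2)|
      <= \sum_(j in J1) #|B j :&: avoiding J2|.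
    exact: card_bigcup_le.
  move: sumle; set s := \sum_(j in _) _; set a := #|avoiding J2|.
  set b := #|avoiding J|; set c := #|_|; move=> h1 h2 h3.
  have : 2 * s <= a by rewrite -(leq_pmul2l d_gt0); lia.
  lia.
have : 2 * d * #|B i :&: avoiding J| <= 2 * d * #|B i :&: avoiding J2|.
  by rewrite leq_mul2l leB orbT.
lia.
Qed.

(** One more event removes at most a fraction [1 / (2 d) < 1] of what the earlier ones leave, so
    something always remains. *)
Lemma local_lemma : exists w, forall i, w \notin B i.
Proof.
suff avJ (J : {set I}) : 0 < #|avoiding J|.
  have /card_gt0P[w /bigcapP wI] := avJ setT.
  by exists w => i; have := wI i (in_setT _); rewrite inE.
have [n] := ubnP #|J|; elim: n => // n IH in J *; rewrite ltnS => leJn.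
have [->|/set0Pn[i iJ]] := eqVneq J set0.
  suff -> : avoiding set0 = setT by rewrite cardsT.
  by rewrite /avoiding big_set0.
have : 0 < #|avoiding (J :\ i)|.
  by apply: IH; move: leJn; rewrite (cardsD1 i) iJ.
have -> : avoiding J = avoiding (J :\ i) :\: B i.
  by rewrite [RHS]setDE setIC /avoiding (big_setD1 i iJ).
have := local_lemma_step (J :\ i) i; rewrite cardsD setIC.
move: (#|avoiding _|) (#|_ :&: _|) => y x.
have : x <= d * x by rewrite leq_pmull.
by rewrite -mulnA; lia.
Qed.
End LocalLemma.

(** * Product spaces: independence and concentration *)

(* [mix w w'] takes the coordinates that decide [A] from [w] and those that
   decide [B] from [w']. *)
Lemma mix_indep (Omega : finType) (mix : Omega -> Omega -> Omega)
    (A B : {set Omega}) :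
    (forall w w', mix (mix w w') (mix w' w) = w) ->
    (forall w w', (mix w w' \in A) = (w \in A)) ->
    (forall w w', (mix w w' \in B) = (w' \in B)) ->
  #|A :&: B| * #|Omega| = #|A| * #|B|.
Proof.
move=> mixK mixA mixB.
(* Mixing in both orders is an involution of [Omega * Omega], and it carries the pairs in [setX A B]
   exactly onto those whose first component lies in [A :&: B]. *)
pose phi p : Omega * Omega := (mix p.1 p.2, mix p.2 p.1).
have phiK : involutive phi by case=> w w'; rewrite /phi /= !mixK.
have <- : #|phi @^-1: setX (A :&: B) setT| = #|A| * #|B|.
  rewrite -cardsX; apply: eq_card => -[w w'].
  by rewrite !inE /= mixA mixB andbT.
by rewrite on_card_preimset ?cardsX ?cardsT //; exists phi => p _; apply: phiK.
Qed.

Section Concentration.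
Local Open Scope ring_scope.
Variables (R : realType).

(** Since [expR x * (1 - x) <= 1], it suffices that [(1 + x + 2 x^2) (1 - x) = 1 + x^2 (1 - 2 x)] is
    at least 1. *)
Lemma expR_le_quadratic (x : R) : x <= 1 / 2 -> expR x <= 1 + x + 2 * x ^+ 2.
Proof.
move=> x_le.
have h1 := expR_ge1Dx (- x); have h2 := expR_gt0 x.
have h3 : expR x * expR (- x) = 1 by rewrite expRxMexpNx_1.
have : expR x * (1 - x) <= 1 by rewrite -[leRHS]h3 ler_pM2l.
move: (expR x) h2 => y y_gt0 {h1 h3} hy.
have : 0 <= (1 + x + 2 * x ^+ 2) * (1 - x) - 1 by nra.
by move=> ?; rewrite -(@ler_pM2r _ (1 - x)); nra.
Qed.

Definition mean (T : finType) (F : T -> R) : R := (\sum_w F w) / #|T|%:R.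

Lemma ler_mean (T : finType) (F G : T -> R) :
  (forall w, F w <= G w) -> mean F <= mean G.
Proof.
by move=> le; rewrite ler_wpM2r ?invr_ge0 ?ler0n //; apply: ler_sum.
Qed.

Lemma mean_cst (T : finType) (a : R) : (0 < #|T|)%N -> mean (fun _ : T => a) = a.
Proof.
move=> T_gt0; apply: (@etrans _ _ (a * #|T|%:R / #|T|%:R)).
  by rewrite mulr_natr -sumr_const.
by rewrite mulfK // pnatr_eq0 -lt0n.
Qed.

Lemma meanD (T : finType) (F G : T -> R) :
  mean (fun w => F w + G w) = mean F + mean G.
Proof. by rewrite /mean big_split mulrDl. Qed.

Lemma meanZ (T : finType) (F : T -> R) a : mean (fun w => a * F w) = a * mean F.
Proof. by rewrite /mean -big_distrr mulrA. Qed.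

Lemma meanN (T : finType) (F : T -> R) : mean (fun w => - F w) = - mean F.
Proof. by rewrite /mean sumrN mulNr. Qed.

Lemma mean_sum (T J : finType) (P : pred J) (F : J -> T -> R) :
  mean (fun w => \sum_(j | P j) F j w) = \sum_(j | P j) mean (F j).
Proof. by rewrite /mean exchange_big big_distrl. Qed.

(** Hoeffding's bound with a cruder constant: the quadratic bound on [expR] is applied to
    [s (G w - m)], whose linear term averages to zero, and [1 + 2 s^2 <= expR (2 s^2)]. *)
Lemma mean_exp_osc (T : finType) (G : T -> R) (s : R) : (0 < #|T|)%N ->
    0 <= s <= 1 / 2 -> (forall w w', G w - G w' <= 1) ->
  mean (fun w => expR (s * G w)) <= expR (s * mean G + 2 * s ^+ 2).
Proof.
move=> T_gt0 /andP[s_ge0 s_le] osc; set m := mean G.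
have osc_m w : - 1 <= G w - m <= 1.
  have T0 : 0 < #|T|%:R :> R by rewrite ltr0n.
  have eN a : (a * #|T|%:R) = \sum_(w' : T) a.
    by rewrite sumr_const mulr_natr.
  have em : m * #|T|%:R = \sum_w' G w' by rewrite divfK // gt_eqF.
  apply/andP; split; rewrite -(ler_pM2r T0) mulrBl em eN eN -sumrB;
    apply: ler_sum => w' _; have := osc w w'; have := osc w' w; lra.
have -> : s * m + 2 * s ^+ 2 = (2 * s ^+ 2) + s * m by ring.
rewrite expRD.
apply: (@le_trans _ _ (mean (fun w =>
   (1 + 2 * s ^+ 2 + s * (G w - m)) * expR (s * m)))).
  apply: ler_mean => w.
  have -> : s * G w = s * (G w - m) + s * m by ring.
  rewrite expRD ler_pM2r ?expR_gt0 //.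
  have /andP[h1 h2] := osc_m w.
  apply: le_trans (expR_le_quadratic _) _.
    by apply: le_trans s_le; rewrite ler_piMr.
  have : (s * (G w - m)) ^+ 2 <= s ^+ 2.
    rewrite exprMn -[leRHS]mulr1 ler_wpM2l ?sqr_ge0 //.
    by move: h1 h2; move: (G w - m) => g; nra.
  lra.
rewrite (_ : mean _ = (1 + 2 * s ^+ 2) * expR (s * m)).
  by rewrite ler_pM2r ?expR_gt0 // expR_ge1Dx.
have e0 : mean (fun w => G w - m) = 0 by rewrite meanD mean_cst //; apply: subrr.
transitivity (mean (fun w => (1 + 2 * s ^+ 2) * expR (s * m)
   + s * expR (s * m) * (G w - m))); last first.
  by rewrite meanD mean_cst // meanZ e0 mulr0 addr0.
by congr (_ / _); apply: eq_bigr => w _; ring.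
Qed.

Section Product.
Variables (K W : finType).
Hypothesis W_gt0 : (0 < #|W|)%N.
Implicit Types (w : {ffun K -> W}) (F : {ffun K -> W} -> R).

Definition upd w c a : {ffun K -> W} := [ffun c' => if c' == c then a else w c'].

Lemma upd_id w c : upd w c (w c) = w.
Proof. by apply/ffunP => c'; rewrite ffunE; case: eqP => [->|]. Qed.

Lemma upd_upd w c a b : upd (upd w c a) c b = upd w c b.
Proof. by apply/ffunP => c'; rewrite !ffunE; case: eqP. Qed.

Lemma updC w c c' a b : c != c' -> upd (upd w c a) c' b = upd (upd w c' b) c a.
Proof.
move=> ne; apply/ffunP => x; rewrite !ffunE.
by case: (x =P c') => [->|//]; rewrite eq_sym (negbTE ne).
Qed.

Definition lipschitz F := forall w c a b, F (upd w c a) - F (upd w c b) <= 1.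

(** The conditional expectation of [F] given all coordinates except [c]. *)
Definition average c F w := mean (fun a => F (upd w c a)).

Lemma mean_average c F : mean (average c F) = mean F.
Proof.
rewrite /average /mean -big_distrl /=.
(* Exchanging the coordinate [w c] with the fresh value is an involution, so resampling preserves
   the uniform measure. *)
pose phi (p : {ffun K -> W} * W) := (upd p.1 c p.2, p.1 c).
have phiK : involutive phi.
  by case=> w a; rewrite /phi /= upd_upd upd_id ffunE eqxx.
rewrite pair_bigA /= (reindex_inj (inv_inj phiK)) /=.
rewrite (eq_bigr (fun p : {ffun K -> W} * W => F p.1)); last first.
  by case=> w a _; rewrite /phi /= upd_upd upd_id.
rewrite -(pair_bigA _ (fun w (a : W) => F w)) /=.
rewrite (eq_bigr (fun w => #|W|%:R * F w)); last first.
  by move=> w _; rewrite sumr_const mulr_natl.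
rewrite -big_distrr /=; congr (_ / _).
by rewrite mulrAC divff ?mul1r // pnatr_eq0 -lt0n.
Qed.

Lemma average_lipschitz c F : lipschitz F -> lipschitz (average c F).
Proof.
move=> lipF w c' a b; rewrite /average -meanN -meanD.
rewrite -(@mean_cst W 1) //; apply: ler_mean => x.
have [->|ne] := eqVneq c' c; first by rewrite !upd_upd subrr.
by rewrite updC // [upd (upd w _ b) _ _]updC //.
Qed.

Lemma average_const c c' F w a :
    (forall w a, F (upd w c' a) = F w) ->
  average c F (upd w c' a) = average c F w.
Proof.
move=> Fc'; congr (_ / _); apply: eq_bigr => x _.
have [->|ne] := eqVneq c' c; first by rewrite upd_upd.
by rewrite updC // Fc'.
Qed.

Lemma invariant_const F :
  (forall w c a, F (upd w c a) = F w) -> forall w w', F w = F w'.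
Proof.
move=> Fupd w w'.
have walk (s : seq K) :
    F [ffun c => if c \in s then w' c else w c] = F w.
  elim: s => [|c s IH]; first by congr F; apply/ffunP => c; rewrite ffunE.
  rewrite -{}[RHS]IH -[RHS](Fupd _ c (w' c)); congr F; apply/ffunP => x.
  by rewrite !ffunE inE; case: (x =P c) => [->|].
rewrite -(walk (enum K)); congr F; apply/ffunP => c.
by rewrite ffunE mem_enum.
Qed.

Lemma mean_exp_average s F c : 0 <= s <= 1 / 2 -> lipschitz F ->
  mean (fun w => expR (s * F w)) <=
    expR (2 * s ^+ 2) * mean (fun w => expR (s * average c F w)).
Proof.
move=> s_in lipF; rewrite -(mean_average c) -meanZ; apply: ler_mean => w.
rewrite -expRD addrC; apply: mean_exp_osc => // a b; exact: lipF.
Qed.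

(** The argument of McDiarmid's inequality: coordinates are averaged out one at a time, each at the
    cost of a factor [expR (2 s^2)], and once all are averaged the function is the constant
    [mean F]. *)
Lemma mean_exp_lipschitz s F : 0 <= s <= 1 / 2 -> lipschitz F ->
  mean (fun w => expR (s * F w)) <= expR (s * mean F + 2 * s ^+ 2 * #|K|%:R).
Proof.
move=> s_in lipF.
have step (cs : seq K) (G := foldr average F cs) :
  [/\ lipschitz G, mean G = mean F, forall w c a, c \in cs -> G (upd w c a) = G w
    & mean (fun w => expR (s * F w)) <=
        expR (2 * s ^+ 2 * (size cs)%:R) * mean (fun w => expR (s * G w))].
  rewrite {}/G; elim: cs => [|c cs [lipG mG cG leG]] /=.
    by split=> //; rewrite mulr0 expR0 mul1r.
  split.
  - exact: average_lipschitz.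
  - by rewrite mean_average.
  - move=> w c' a; rewrite inE => /predU1P[->|c'cs].
      by congr (_ / _); apply: eq_bigr => x _; rewrite upd_upd.
    by apply: average_const => w' a'; apply: cG.
  apply: le_trans leG _; rewrite -(natr1 (size cs)) mulrDr mulr1 expRD -[leRHS]mulrA.
  by rewrite ler_pM2l ?expR_gt0 //; apply: mean_exp_average.
have [_ mG cG] := step (enum K); rewrite -cardE.
set G := foldr _ _ _ in mG cG *.
have N_gt0 : (0 < #|{: {ffun K -> W}}|)%N by rewrite card_ffun expn_gt0 W_gt0.
have GE w : G w = mean F.
  rewrite -mG -(@mean_cst {ffun K -> W} (G w)) //; congr (_ / _).
  apply: eq_bigr => w' _; apply: invariant_const => w1 c a.
  by apply: cG; rewrite mem_enum.
move=> /le_trans; apply; rewrite addrC expRD ler_pM2l ?expR_gt0 //.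
by rewrite -[leRHS](@mean_cst {ffun K -> W}) //; apply: ler_mean => w; rewrite GE.
Qed.

(* With [s = t / 4] the exponent is [- s t m + 2 s^2 m = - t^2 m / 8]. *)
Lemma lipschitz_tail F mu t : 0 <= t <= 1 -> lipschitz F -> mean F <= mu ->
  #|[set w | mu + t * #|K|%:R < F w]|%:R
    <= expR (- (t ^+ 2 * #|K|%:R / 8)) * #|{: {ffun K -> W}}|%:R.
Proof.
move=> /andP[t0 t1] lipF leF; set m := #|K|%:R.
have m0 : 0 <= m :> R by rewrite ler0n.
pose s := t / 4.
have s_in : 0 <= s <= 1 / 2 by rewrite /s; lra.
have s0 : 0 <= s by case/andP: s_in.
have N0 : 0 < #|{: {ffun K -> W}}|%:R :> R.
  by rewrite ltr0n card_ffun expn_gt0 W_gt0.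
have := mean_exp_lipschitz s_in lipF; rewrite ler_pdivrMr //.
set B := [set w | _].
have leB : #|B|%:R * expR (s * (mu + t * m)) <= \sum_w expR (s * F w).
  rewrite mulr_natl -sumr_const [leLHS]big_mkcond /=; apply: ler_sum => w _.
  case: ifP => [|_]; last exact: expR_ge0.
  by rewrite inE => ltF; rewrite ler_expR ler_wpM2l // ltW.
move=> /(le_trans leB); rewrite -ler_pdivlMr ?expR_gt0 // => /le_trans; apply.
rewrite mulrAC ler_wpM2r ?ler0n // -expRB ler_expR -/m.
have : s * mean F <= s * mu by rewrite ler_wpM2l.
by rewrite /s; nra.
Qed.
End Product.
End Concentration.

(** * The real inequalities behind the gain *)

Section Hyperbola.
Local Open Scope ring_scope.
Variable R : realFieldType.
Implicit Types (k x y a b c d s : R).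

Definition slope k : R := (k - 2) / (k - 1).
(** The contribution of an edge that misses a fraction [x] of [T]: [x] times the weight
    [(2 + slope k * x)^-1] given to that edge. *)
Definition hyp k x : R := x / (2 + slope k * x).
(* This is [hyp k ((k - 1) / k ^ 2)]. *)
Definition gain k : R := (k - 1) / (2 * k ^+ 2 + k - 2).

Lemma slope_ge0 k : 2 <= k -> 0 <= slope k.
Proof. by move=> k2; rewrite /slope divr_ge0; lra. Qed.

Lemma hyp_den_gt0 k x : 2 <= k -> 0 <= x -> 0 < 2 + slope k * x.
Proof. by move=> /slope_ge0 s0 x0; have := mulr_ge0 s0 x0; lra. Qed.

Lemma hyp_le k x y : 2 <= k -> 0 <= x -> x <= y -> hyp k x <= hyp k y.
Proof.
move=> k2 x0 xy; have y0 := le_trans x0 xy.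
rewrite /hyp ler_pdivrMr ?hyp_den_gt0 // mulrAC ler_pdivlMr ?hyp_den_gt0 //.
nra.
Qed.

Lemma gain_ge0 k : 2 <= k -> 0 <= gain k.
Proof. by move=> k2; rewrite /gain divr_ge0; nra. Qed.

Lemma gain_le k : 2 <= k -> gain k * k / (k - 1) <= 1 / 2.
Proof.
move=> k2; rewrite /gain.
have -> : (k - 1) / (2 * k ^+ 2 + k - 2) * k / (k - 1) = k / (2 * k ^+ 2 + k - 2).
  by field; apply/andP; split; nra.
by rewrite ler_pdivrMr; nra.
Qed.

(* Equality holds at [a = b = 1 - 1/k], which is where [slope k] comes from. *)
Lemma inv_le_hyp_weights k a b : 2 <= k ->
    0 <= a <= 1 - k^-1 -> 0 <= b <= 1 - k^-1 ->
  (2 + slope k * a)^-1 + (2 + slope k * b)^-1 <= 2 / (1 + a + b).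
Proof.
move=> k2; set q := 1 - k^-1 => /andP[a0 aq] /andP[b0 bq].
have k0 : 0 < k by lra.
have q2 : 1 / 2 <= q.
  have : k^-1 <= 2^-1 by rewrite lef_pV2 ?posrE.
  by rewrite /q; lra.
have q1 : q <= 1 by rewrite /q gerBl invr_ge0 ltW.
have sq : slope k * q = 2 * q - 1.
  by rewrite /slope /q; field; apply/andP; split; lra.
have A0 := hyp_den_gt0 k2 a0; have B0 := hyp_den_gt0 k2 b0.
have s0 := slope_ge0 k2; move: (slope k) sq A0 B0 s0 => s sq A0 B0 s0.
have -> : (2 + s * a)^-1 + (2 + s * b)^-1 =
  (4 + s * (a + b)) / ((2 + s * a) * (2 + s * b)).
  by field; apply/andP; split; lra.
rewrite ler_pdivrMr ?mulr_gt0 // mulrAC ler_pdivlMr; last by lra.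
(* The factor [q ^+ 2] lets every [s] be replaced through [s * q = 2 * q - 1]; the result is a
   combination of the slacks [q - a] and [q - b] with nonnegative coefficients. *)
rewrite -subr_ge0 -(@pmulr_rge0 _ (q ^+ 2)); last by nra.
have -> : q ^+ 2 * (2 * ((2 + s * a) * (2 + s * b)) -
    (4 + s * (a + b)) * (1 + a + b)) =
  4 * q ^+ 2 + 3 * q * (s * q) * (a + b) - 4 * q ^+ 2 * (a + b)
    - q * (s * q) * (a + b) ^+ 2 + 2 * (s * q) ^+ 2 * (a * b) by ring.
rewrite sq (_ : _ + _ = (q - a + (q - b)) *
  (q * (2 - (2 * q - 1) ^+ 2) + q * (2 * q - 1) * (a + b))
  + 2 * (2 * q - 1) ^+ 2 * ((q - a) * (q - b))); last by ring.
apply: addr_ge0; last by apply: mulr_ge0; rewrite mulr_ge0 ?sqr_ge0 ?subr_ge0.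
apply: mulr_ge0; first by lra.
apply: addr_ge0; first by rewrite mulr_ge0 //; nra.
apply: mulr_ge0; last exact: addr_ge0.
by rewrite mulr_ge0 //; lra.
Qed.

(** Concavity in tangent form: the slope of [hyp k] at [x] is [2 / (2 + slope k * x) ^+ 2], and the
    gap to the tangent is an explicit multiple of [(y - x) ^+ 2]. *)
Lemma hyp_tangent k x y : 2 <= k -> 0 <= x -> 0 <= y ->
  hyp k y <= hyp k x + 2 / (2 + slope k * x) ^+ 2 * (y - x).
Proof.
move=> k2 x0 y0; rewrite /hyp.
have A0 := hyp_den_gt0 k2 x0; have B0 := hyp_den_gt0 k2 y0.
have s0 := slope_ge0 k2; move: (slope k) A0 B0 s0 => s A0 B0 s0.
rewrite -subr_ge0 (_ : _ - _ =
   2 * s * (y - x) ^+ 2 / ((2 + s * x) ^+ 2 * (2 + s * y))).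
  by apply: divr_ge0; apply: mulr_ge0; rewrite ?sqr_ge0 ?mulr_ge0 // ltW.
by field; apply/andP; split; lra.
Qed.

(** Jensen's inequality for [k - 1] points whose average is [X]. Missing points count as zeros,
    which is harmless because the tangent at [X] has the nonnegative intercept [hyp k X - t * X]. *)
Lemma hyp_concave (J : finType) (P : pred J) k (y : J -> R) :
    2 <= k -> (forall j, P j -> 0 <= y j) -> #|P|%:R <= k - 1 ->
  (\sum_(j | P j) hyp k ((1 - k^-1) * y j)) / (k - 1) <=
    hyp k (k^-1 * \sum_(j | P j) y j).
Proof.
move=> k2 y0 leP; set X := k^-1 * _.
have k0 : 0 < k by lra.
have S0 : 0 <= \sum_(j | P j) y j by apply: sumr_ge0.
have X0 : 0 <= X by rewrite mulr_ge0 // invr_ge0 ltW.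
have q0 : 0 <= 1 - k^-1 by rewrite subr_ge0 invf_le1 //; lra.
rewrite ler_pdivrMr; last by lra.
set t := 2 / (2 + slope k * X) ^+ 2.
have D0 := hyp_den_gt0 k2 X0.
apply: (@le_trans _ _ (\sum_(j | P j) ((hyp k X - t * X)
     + t * (1 - k^-1) * y j))).
  apply: ler_sum => j Pj.
  apply: le_trans (hyp_tangent k2 X0 (mulr_ge0 q0 (y0 j Pj))) _.
  by rewrite -/t; lra.
rewrite big_split /= sumr_const -big_distrr /= -mulr_natr.
have -> : t * (1 - k^-1) * \sum_(j | P j) y j = t * X * (k - 1).
  by rewrite /X; move: (\sum_(j | P j) y j) (t) => S t'; field; rewrite gt_eqF.
have tX : t * X <= hyp k X.
  rewrite /t /hyp mulrAC ler_pdivrMr ?exprn_gt0 // mulrAC ler_pdivlMr //.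
  have := slope_ge0 k2; move: (slope k) D0 => s D0 s0.
  have -> : X * (2 + s * X) ^+ 2 = 2 * X * (2 + s * X) + s * X ^+ 2 * (2 + s * X).
    by ring.
  rewrite lerDl; apply: mulr_ge0; last exact: ltW.
  by rewrite mulr_ge0 ?sqr_ge0.
suff : (hyp k X - t * X) * #|P|%:R <= (hyp k X - t * X) * (k - 1) by lra.
by rewrite ler_wpM2l // subr_ge0.
Qed.

(* The worst case is [d v = s / k]: each term is convex in [d v]. *)
Lemma hyp_convex (J : finType) (P : pred J) k (d : J -> R) :
    2 <= k -> (forall j, P j -> 0 <= d j) -> #|P|%:R = k ->
    \sum_(j | P j) d j <= 1 ->
  (\sum_(j | P j) d j) * gain k <=
    \sum_(j | P j) d j * hyp k ((1 - k^-1) * (1 - \sum_(i | P i) d i + d j)).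
Proof.
move=> k2 d0 cardP; set s := \sum_(j | P j) d j => s1.
have k0 : 0 < k by lra.
have s0 : 0 <= s by apply: sumr_ge0.
pose b := (k - 2) / k; pose c := 1 - s; pose z := c + s / k.
have b0 : 0 <= b by rewrite divr_ge0 //; lra.
have c0 : 0 <= c by rewrite subr_ge0.
have sk : 0 <= s / k by rewrite divr_ge0 // ltW.
have hypE x : 0 <= x -> hyp k ((1 - k^-1) * x) = (1 - k^-1) * (x / (2 + b * x)).
  move=> x0; rewrite /hyp /slope /b; have := mulr_ge0 b0 x0 => bx.
  have -> : (k - 2) / (k - 1) * ((1 - k^-1) * x) = (k - 2) / k * x.
    by field; apply/andP; split; lra.
  by rewrite mulrA.
have gainE : gain k = (1 - k^-1) * (k^-1 / (2 + b * k^-1)).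
  rewrite /gain /b; field.
  by apply/andP; split; nra.
rewrite gainE mulrCA (eq_bigr (fun j =>
   (1 - k^-1) * (d j * ((c + d j) / (2 + b * (c + d j)))))); last first.
  move=> j Pj; have dj := d0 j Pj; rewrite hypE; last by lra.
  by rewrite -/c mulrCA.
rewrite -big_distrr /= ler_wpM2l //; first by rewrite subr_ge0 invf_le1 //; lra.
have Pz : 0 < 2 + b * z by have := mulr_ge0 b0 c0; have := mulr_ge0 b0 sk; rewrite /z; nra.
have Pk : 0 < 2 + b * k^-1.
  by apply: ltr_wpDr => //; rewrite mulr_ge0 // invr_ge0 ltW.
(* [m] is the derivative at [x = z] of [(x - c) (x - k^-1) / (2 + b x)], where [x] stands for
   [c + d j]; [z] is the value at the average [d j = s / k]. *)
pose m := ((2 * z - c - k^-1) * (2 + b * z) - b * (z - c) * (z - k^-1))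
  / (2 + b * z) ^+ 2.
have tangent j : P j -> (z - c) * (z - k^-1) / (2 + b * z) + m * (d j - s / k) <=
    d j * (c + d j - k^-1) / (2 + b * (c + d j)).
  move=> Pj; have dj := d0 j Pj.
  have Px : 0 < 2 + b * (c + d j) by have := mulr_ge0 b0 c0; have := mulr_ge0 b0 dj; lra.
  rewrite -subr_ge0 (_ : _ - _ = (2 + b * c) * (2 + b * k^-1) *
     (d j - s / k) ^+ 2 / ((2 + b * (c + d j)) * (2 + b * z) ^+ 2)).
    apply: divr_ge0; apply: mulr_ge0; rewrite ?sqr_ge0 ?ltW //.
    by apply: mulr_gt0 => //; have := mulr_ge0 b0 c0; lra.
  rewrite /m (_ : s / k = z - c); last by rewrite /z; ring.
  by field; rewrite !gt_eqF.
rewrite -subr_ge0 big_distrl /= -sumrB.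
(* Subtracting [k^-1 / (2 + b * k^-1)] from [x / (2 + b * x)] leaves a multiple of
   [(x - k^-1) / (2 + b * x)], the form bounded by [tangent]. *)
rewrite (eq_bigr (fun j => 2 / (2 + b * k^-1) *
   (d j * (c + d j - k^-1) / (2 + b * (c + d j))))); last first.
  move=> j Pj; have dj := d0 j Pj.
  have Px : 0 < 2 + b * (c + d j) by have := mulr_ge0 b0 c0; have := mulr_ge0 b0 dj; lra.
  move: (c + d j) (b) Px b0 => x b' Px b0'; field.
  by rewrite !gt_eqF //=; lra.
rewrite -big_distrr /=; apply: mulr_ge0; first by rewrite divr_ge0 // ltW.
apply: (@le_trans _ _ (\sum_(j | P j)
  ((z - c) * (z - k^-1) / (2 + b * z) + m * (d j - s / k)))); last first.
  exact: ler_sum.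
rewrite big_split /= sumr_const -big_distrr /= sumrB sumr_const -/s.
(* The linear terms cancel since there are exactly [k] summands. The constant ones are nonnegative
   because [z - k^-1 = c * (1 - k^-1)]. *)
rewrite -[s / k *+ _]mulr_natr cardP divfK ?gt_eqF // subrr mulr0 addr0.
apply: mulrn_wge0; apply: divr_ge0; last exact: ltW.
rewrite /z; apply: mulr_ge0; first by lra.
have -> : c + s / k - k^-1 = c * (1 - k^-1) by rewrite /c; ring.
by rewrite mulr_ge0 // subr_ge0 invf_le1 //; lra.
Qed.
End Hyperbola.

(** * Sparsity of neighborhoods *)

Section Hypergraph.
Variables (V E : finType) (es : E -> {set V}).
Implicit Types (A : {set E}) (e f g : E) (v : V).

Definition meets f g := es f :&: es g != set0.
Definition closed_nbhd A f := [set g in A | meets f g].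
Definition star A v := [set g in A | v \in es g].

Lemma meetsC f g : meets f g = meets g f.
Proof. by rewrite /meets setIC. Qed.

Lemma meets_exP f g : reflect (exists2 v, v \in es f & v \in es g) (meets f g).
Proof.
apply: (iffP (set0Pn _)) => [[v]|[v vf vg]]; last by exists v; rewrite inE vf.
by rewrite inE => /andP[]; exists v.
Qed.

Variables (k D : nat) (A : {set E}).
Hypothesis k_ge2 : 2 <= k.
Hypothesis unif : forall f, f \in A -> #|es f| = k.
Hypothesis star_le : forall v, #|star A v| <= D.

Lemma card_closed_nbhd f : f \in A -> #|closed_nbhd A f| <= k * D.
Proof.
move=> fA; have sub : closed_nbhd A f \subset \bigcup_(v in es f) star A v.
  apply/subsetP => g; rewrite inE => /andP[gA /meets_exP[v vf vg]].
  by apply/bigcupP; exists v => //; rewrite inE gA.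
apply: leq_trans (subset_leq_card sub) _.
apply: leq_trans (card_bigcup_le _ _) _.
by rewrite -(unif fA) -sum_nat_const; apply: leq_sum => v _.
Qed.

Section Neighborhood.
Variable e : E.
Hypothesis eA : e \in A.
Let F := closed_nbhd A e.

(* Vertices outside [e] are charged to the part [star A v] of the neighborhood
   of [e] through one chosen vertex [v = anchor g] of [e]. *)
Lemma anchor_ex : {a : E -> V | forall g, g \in F -> a g \in es e :&: es g}.
Proof.
have /card_gt0P/sigW[v0 _] : 0 < #|es e| by rewrite unif //; lia.
exists (fun g => odflt v0 [pick v in es e :&: es g]) => g gF.
case: pickP => [v //|] /=; move: gF; rewrite inE => /andP[_ /set0Pn[v vI]].
by move/(_ v); rewrite vI.
Qed.

Let a := sval anchor_ex.
Let aP g : g \in F -> a g \in es e :&: es g := svalP anchor_ex g.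

Let s u := #|[set g in F | u \in es g]|.
Let c u v := #|[set g in F | (u \in es g) && (a g == v)]|.

Lemma s_le u : s u <= D.
Proof.
apply: leq_trans (star_le u); apply: subset_leq_card; apply/subsetP => g.
by rewrite !inE => /andP[/andP[-> _] ->].
Qed.

Lemma sum_c u : \sum_(v in es e) c u v = s u.
Proof.
rewrite /s -sum1_card (partition_big a (mem (es e))) /=.
  apply: eq_bigr => v _; rewrite /c -sum1_card; apply: eq_bigl => g.
  by rewrite !inE andbA.
by move=> g; rewrite inE => /andP[/aP]; rewrite inE => /andP[].
Qed.

(** An edge of [F] meeting [g] either lies in the star of a vertex of [g] in [e], which covers every
    edge with the anchor of [g], or meets [g] at some [u] outside [e] and has another anchor. Hence
    the [c u (a g)] edges need not be counted at [u]. *)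
Lemma card_common_nbhd g : g \in F ->
  #|closed_nbhd A g :&: F| + \sum_(u in es g :\: es e) c u (a g)
    <= #|es g :&: es e| * D + \sum_(u in es g :\: es e) s u.
Proof.
move=> gF; set P := es g :\: es e.
have sub : closed_nbhd A g :&: F \subset
    (\bigcup_(v in es g :&: es e) star A v) :|:
    \bigcup_(u in P) [set f in F | (u \in es f) && (a f != a g)].
  apply/subsetP => f; rewrite inE => /andP[].
  rewrite inE => /andP[fA /meets_exP[u ug uf]] fF; rewrite inE.
  have [afg|afg] := eqVneq (a f) (a g).
    apply/orP; left; apply/bigcupP; exists (a g).
      by rewrite setIC aP.
    by rewrite inE fA -afg; have := aP fF; rewrite inE => /andP[].
  have [ue|ue] := boolP (u \in es e).
    by apply/orP; left; apply/bigcupP; exists u; rewrite !inE ?ug ?fA.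
  apply/orP; right; apply/bigcupP; exists u; first by rewrite inE ue.
  by rewrite inE fF uf.
have := leq_trans (subset_leq_card sub) (leq_card_setU _ _).
have h1 : #|\bigcup_(v in es g :&: es e) star A v| <= #|es g :&: es e| * D.
  rewrite -sum_nat_const; apply: leq_trans (card_bigcup_le _ _) _.
  by apply: leq_sum => v _.
have h2 : #|\bigcup_(u in P) [set f in F | (u \in es f) && (a f != a g)]|
    + \sum_(u in P) c u (a g) <= \sum_(u in P) s u.
  have -> : \sum_(u in P) s u =
      \sum_(u in P) #|[set f in F | (u \in es f) && (a f != a g)]|
      + \sum_(u in P) c u (a g).
    rewrite -big_split /=; apply: eq_bigr => u _.
    rewrite /s -(cardsID [set f | a f != a g] [set f in F | u \in es f]).
    by congr (_ + _); apply: eq_card => f; rewrite !inE; case: (a f == a g);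
       rewrite /= ?andbT ?andbF.
  by rewrite leq_add2r card_bigcup_le.
lia.
Qed.

Lemma closed_nbhd_cover : F = \bigcup_(v in es e) star A v.
Proof.
apply/setP => g; rewrite inE; apply/andP/bigcupP => [[gA /meets_exP[v ve vg]]|].
  by exists v; rewrite // inE gA.
by case=> v ve; rewrite inE => /andP[gA vg]; split=> //; apply/meets_exP; exists v.
Qed.

(** [F] is a union of [k] stars; those centered in [P] are absorbed by [B] and the others cost [D]
    each. *)
Lemma card_closed_nbhd_minus (P : {set V}) (B : {set E}) : P \subset es e ->
  (forall v, v \in P -> star A v \subset B) -> #|F| <= #|B| + (k - #|P|) * D.
Proof.
move=> sP sB; have cov : F \subset B :|: \bigcup_(v in es e :\: P) star A v.
  rewrite closed_nbhd_cover; apply/bigcupsP => v ve.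
  have [vP|vP] := boolP (v \in P); first exact: subset_trans (sB v vP) (subsetUl _ _).
  by apply: subset_trans (subsetUr _ _); rewrite (bigcup_max v) // inE vP.
apply: leq_trans (subset_leq_card cov) _.
apply: leq_trans (leq_card_setU _ _) _; rewrite leq_add2l.
rewrite -(unif eA) -(cardsID P (es e)) (setIidPr sP) addKn -sum_nat_const.
by apply: leq_trans (card_bigcup_le _ _) _; apply: leq_sum => v _.
Qed.

Lemma star_sub_common v f : v \in es e -> v \in es f ->
  star A v \subset closed_nbhd A f :&: F.
Proof.
move=> ve vf; apply/subsetP => g; rewrite !inE => /andP[-> vg] /=.
by apply/andP; split; apply/meets_exP; exists v.
Qed.

Lemma card_closed_nbhd_le1 f : f \in F ->
  #|F| <= #|closed_nbhd A f :&: F| + (k - 1) * D.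
Proof.
rewrite [f \in F]inE => /andP[fA /meets_exP[v ve vf]].
rewrite -(cards1 v); apply: card_closed_nbhd_minus; first by rewrite sub1set.
by move=> w; rewrite inE => /eqP->; apply: star_sub_common.
Qed.

(** Disjoint edges of [F] meet [e] in two different vertices, so two whole stars are absorbed. *)
Lemma card_closed_nbhd_le2 f g : f \in F -> g \in F -> ~~ meets f g ->
  #|F| <= #|closed_nbhd A f :&: F| + #|closed_nbhd A g :&: F| + (k - 2) * D.
Proof.
rewrite [f \in F]inE [g \in F]inE.
move=> /andP[fA /meets_exP[v ve vf]] /andP[gA /meets_exP[w we wg]] nfg.
have vw : v != w by apply: contraNneq nfg => e_vw; apply/meets_exP; exists v; rewrite // e_vw.
apply: (@leq_trans (#|(closed_nbhd A f :&: F) :|: (closed_nbhd A g :&: F)| + (k - 2) * D)).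
  have <- : #|[set v; w]| = 2 by rewrite cards2 vw.
  apply: card_closed_nbhd_minus.
    by apply/subsetP => u; rewrite !inE => /orP[] /eqP->.
  move=> u; rewrite !inE => /orP[] /eqP->.
    exact: subset_trans (star_sub_common ve vf) (subsetUl _ _).
  exact: subset_trans (star_sub_common we wg) (subsetUr _ _).
by rewrite leq_add2r leq_card_setU.
Qed.

Lemma sum_card_anchor : \sum_(g in F) #|es g :&: es e| <= k * D.
Proof.
have -> : \sum_(g in F) #|es g :&: es e| = \sum_(v in es e) #|[set g in F | v \in es g]|.
  rewrite [RHS](sum_card_swap (mem (es e)) (fun v g => (g \in F) && (v \in es g))).
  rewrite [LHS]big_mkcond; apply: eq_bigr => g _; case: (boolP (g \in F)) => gF.
    by apply: eq_card => v; rewrite !inE andbC.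
  by rewrite eq_card0 // => v; rewrite !inE andbF.
by rewrite -(unif eA) -sum_nat_const; apply: leq_sum => v _; apply: s_le.
Qed.

Local Open Scope ring_scope.
Variable R : realFieldType.
Let T : R := (k * D)%:R.

(** Concavity over the vertices of [g] outside [e] bounds each summand below by vertex terms
    ([step1]). These are regrouped by vertex and anchor, and convexity at each vertex gives [gain]
    for every incidence of [F] with a vertex outside [e] ([step2]). The term [(T - #|F|) / 2]
    compensates for a neighborhood with fewer than [T] edges. *)
Lemma hyp_sum_closed_nbhd : (0 < D)%N ->
  T * gain k%:R <= (T - #|F|%:R) / 2 +
    \sum_(g in F) hyp k%:R ((T - #|closed_nbhd A g :&: F|%:R) / T).
Proof.
move=> D_gt0; set h := hyp k%:R; set r := fun g => #|closed_nbhd A g :&: F|.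
have K2 : 2 <= k%:R :> R by rewrite ler_nat.
have K0 : 0 < k%:R :> R by lra.
have D0 : 0 < D%:R :> R by rewrite ltr0n.
have T0 : 0 < T by rewrite ltr0n; lia.
(* The share of [D] left after removing the edges of [F] through [u] whose anchor differs from
   [v]. *)
pose y u v : R := (D%:R - (s u)%:R + (c u v)%:R) / D%:R.
have y0 u v : 0 <= y u v.
  by rewrite divr_ge0 ?ler0n // addr_ge0 ?ler0n // subr_ge0 ler_nat s_le.
have q0 : 0 <= 1 - k%:R^-1 :> R by rewrite subr_ge0 invf_le1 //; lra.
have step1 g : g \in F ->
    (\sum_(u in es g :\: es e) h ((1 - k%:R^-1) * y u (a g))) / (k%:R - 1)
      <= h ((T - (r g)%:R) / T).
  move=> gF; have gA : g \in A by move: gF; rewrite inE => /andP[].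
  have gk : (#|es g :&: es e| + #|es g :\: es e| = k)%N by rewrite cardsID unif.
  have ge1 : (0 < #|es g :&: es e|)%N.
    by apply/card_gt0P; exists (a g); rewrite setIC aP.
  have ltk : (#|es g :\: es e| < k)%N by lia.
  apply: le_trans (hyp_concave K2 _ _) _ => [u _ //||].
    by rewrite lerBrDr natr1 ler_nat.
  apply: hyp_le => //.
    by rewrite mulr_ge0 ?invr_ge0 ?(ltW K0) //; apply: sumr_ge0.
  rewrite ler_pdivlMr // /T natrM -mulr_suml.
  rewrite (_ : _ * _ = \sum_(u in es g :\: es e)
     (D%:R - (s u)%:R + (c u (a g))%:R)); last by field; rewrite !gt_eqF.
  rewrite big_split sumrB /= sumr_const -!natr_sum.
  have := card_common_nbhd gF; rewrite -(ler_nat R) !natrD -natrM -/(r g).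
  rewrite -mulrnA.
  set x1 := (\sum_(u in _) c u (a g))%N; set x2 := (\sum_(u in _) s u)%N => le1.
  have : (k * D)%:R = (#|es g :&: es e| * D)%:R + (D * #|es g :\: es e|)%:R :> R.
    by rewrite -natrD -gk mulnDl [(D * _)%N]mulnC.
  rewrite natrM => eT; lra.
have step2 : (\sum_(g in F) (k - #|es g :&: es e|)%:R) * gain k%:R <=
    \sum_(g in F) \sum_(u in es g :\: es e) h ((1 - k%:R^-1) * y u (a g)).
  rewrite [leRHS](exchange_big_dep (fun u => u \notin es e)) /=; last first.
    by move=> g u _; rewrite inE => /andP[].
  have -> : \sum_(g in F) (k - #|es g :&: es e|)%:R =
      \sum_(u | u \notin es e) (s u)%:R :> R.
    rewrite -!natr_sum; congr _%:R.
    rewrite [RHS](sum_card_swap [pred u | u \notin es e]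
      (fun u g => (g \in F) && (u \in es g))).
    rewrite [LHS]big_mkcond; apply: eq_bigr => g _; case: (boolP (g \in F)) => gF.
      have gA : g \in A by move: gF; rewrite inE => /andP[].
      rewrite -(unif gA) -[X in (X - _)%N](cardsID (es e)) addKn.
      by apply: eq_card => v; rewrite !inE.
    by rewrite eq_card0 // => v; rewrite !inE andbF.
  rewrite big_distrl; apply: ler_sum => u ue /=.
  have -> : \sum_(g in F | u \in es g :\: es e) h ((1 - k%:R^-1) * y u (a g))
      = \sum_(v in es e) (c u v)%:R * h ((1 - k%:R^-1) * y u v).
    rewrite (eq_bigl (fun g => (g \in F) && (u \in es g))); last first.
      by move=> g; rewrite in_setD ue.
    rewrite (partition_big a (mem (es e))) /=; last first.
      by move=> g /andP[/aP]; rewrite inE => /andP[].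
    apply: eq_bigr => v _.
    rewrite (eq_bigr (fun=> h ((1 - k%:R^-1) * y u v))); last first.
      by move=> g /andP[_ /eqP->].
    rewrite sumr_const mulr_natl; congr (_ *+ _).
    by apply: eq_card => g; rewrite !inE unfold_in -andbA inE.
  (* The edges of [F] through [u], split by anchor, are the [k] variables of [hyp_convex]; their sum
     is at most 1 because [s u <= D]. *)
  pose d v : R := (c u v)%:R / D%:R.
  have sd : \sum_(v in es e) d v = (s u)%:R / D%:R.
    by rewrite -mulr_suml -natr_sum sum_c.
  have cv : (s u)%:R / D%:R * gain k%:R * D%:R <= (\sum_(v in es e)
      d v * hyp k%:R ((1 - k%:R^-1) * (1 - (s u)%:R / D%:R + d v))) * D%:R.
    rewrite ler_pM2r // -sd; apply: hyp_convex K2 _ _ _ => [v _||].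
    - by rewrite divr_ge0.
    - by rewrite unif.
    - by rewrite sd ler_pdivrMr // mul1r ler_nat s_le.
  apply: (le_trans (le_trans _ cv)).
    by rewrite mulrAC divfK ?gt_eqF.
  rewrite big_distrl; apply: ler_sum => v _ /=.
  rewrite mulrAC divfK ?gt_eqF // (_ : 1 - _ + _ = y u v) //.
  by rewrite /y /d; field; rewrite gt_eqF.
have K1 : 0 < k%:R - 1 :> R by lra.
apply: (@le_trans _ _ ((T - #|F|%:R) / 2 +
   (\sum_(g in F) (k - #|es g :&: es e|)%:R) * gain k%:R / (k%:R - 1))); last first.
  rewrite lerD2l; apply: (@le_trans _ _ (\sum_(g in F)
    (\sum_(u in es g :\: es e) h ((1 - k%:R^-1) * y u (a g))) / (k%:R - 1))).
    by rewrite -mulr_suml ler_pM2r ?invr_gt0.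
  exact: ler_sum.
have := sum_card_anchor; rewrite -(ler_nat R) -/T natr_sum.
have nQ : #|F|%:R <= \sum_(g in F) (#|es g :&: es e|%:R : R).
  rewrite -sum1_card natr_sum; apply: ler_sum => g gF; rewrite ler_nat.
  by apply/card_gt0P; exists (a g); rewrite setIC aP.
have -> : \sum_(g in F) (k - #|es g :&: es e|)%:R =
    k%:R * #|F|%:R - \sum_(g in F) (#|es g :&: es e|%:R : R).
  rewrite mulr_natr -sumr_const -sumrB; apply: eq_bigr => g gF.
  have gA : g \in A by move: gF; rewrite inE => /andP[].
  by rewrite natrB // -(unif gA) subset_leq_card ?subsetIl.
move: nQ; set Q := \sum_(g in F) _; set n : R := #|F|%:R => nQ QT.
have g1 := gain_le K2; have g0 := gain_ge0 K2.
have g2 : gain k%:R <= 1 / 2 :> R.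
  apply: le_trans g1; rewrite -mulrA ler_peMr // ler_pdivlMr //; lra.
(* Two kinds of slack: [T - Q] measures missing degree at the vertices of [e], and [Q - n] the edges
   meeting [e] in several vertices. Both coefficients are nonnegative, by [g2] and [gain_le]. *)
rewrite -subr_ge0 (_ : _ - _ = (T - Q) * (1 / 2 - gain k%:R)
   + (Q - n) * (1 / 2 - gain k%:R * k%:R / (k%:R - 1))); last first.
  by move: (gain _) => G; field; rewrite gt_eqF.
by rewrite addr_ge0 // mulr_ge0 // subr_ge0.
Qed.
End Neighborhood.
End Hypergraph.

(** * Random labels *)

Section Labels.
Variables (I : finType) (M : nat).
Notation label := {ffun I -> 'I_M}.
Implicit Types (x : label) (a b : I) (Z W U : {set I}) (C : {set label}).

Definition strict_min x a Z := [forall b in Z, (b != a) ==> (x a < x b)].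
Definition ties Z : {set label} :=
  [set x : label | [exists a in Z, exists b in Z, (a != b) && (x a == x b)]].

Lemma strict_minP x a Z :
  reflect (forall b, b \in Z -> b != a -> x a < x b) (strict_min x a Z).
Proof.
by apply: (iffP forall_inP) => h b bZ; [apply/implyP/h | apply/implyP => ?; apply: h].
Qed.

Lemma strict_minS x a Z W : Z \subset W -> strict_min x a W -> strict_min x a Z.
Proof.
by move=> /subsetP sZW /strict_minP h; apply/strict_minP => b /sZW; apply: h.
Qed.

Lemma ties_leS Z W : Z \subset W -> #|ties Z| <= #|ties W|.
Proof.
move=> /subsetP sZW; apply/subset_leq_card/subsetP => x; rewrite !inE.
case/exists_inP => a /sZW aW /exists_inP[b /sZW bW ab].
by apply/exists_inP; exists a => //; apply/exists_inP; exists b.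
Qed.

Definition relabel (t : {perm I}) x : label := [ffun b => x (t b)].

Lemma relabel_inj t : injective (relabel t).
Proof.
move=> x y /ffunP exy; apply/ffunP => b.
by have := exy (t^-1%g b); rewrite !ffunE permKV.
Qed.

Lemma strict_min_relabel (t : {perm I}) x a Z : (forall b, (t b \in Z) = (b \in Z)) ->
  strict_min (relabel t x) a Z = strict_min x (t a) Z.
Proof.
move=> tZ; apply/strict_minP/strict_minP => h b bZ ba.
  have := h (t^-1%g b); rewrite -tZ !ffunE permKV; apply => //.
  by apply: contraNneq ba => <-; rewrite permKV.
by rewrite !ffunE; apply: h; rewrite ?tZ // (inj_eq perm_inj).
Qed.

Lemma tperm_stable a b Z c : a \in Z -> b \in Z -> (tperm a b c \in Z) = (c \in Z).
Proof. by move=> aZ bZ; case: tpermP => [->|->|//]; rewrite ?aZ ?bZ. Qed.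

(** Exchanging the labels of [a] and [b] is a bijection of the outcomes that preserves [C] and swaps
    the two events. *)
Lemma card_strict_min_eq C W a b : a \in W -> b \in W ->
    (forall x, (relabel (tperm a b) x \in C) = (x \in C)) ->
  #|[set x in C | strict_min x a W]| = #|[set x in C | strict_min x b W]|.
Proof.
move=> aW bW stabC; pose t := tperm a b.
rewrite -(card_imset _ (@relabel_inj t)); apply: eq_card => x.
have tt y : relabel t (relabel t y) = y.
  by apply/ffunP => c; rewrite !ffunE tpermK.
apply/imsetP/idP => [[y yP ->]|xP]; last first.
  exists (relabel t x); last by rewrite tt.
  move: xP; rewrite !inE stabC => /andP[-> /=].
  by rewrite strict_min_relabel ?tpermL // => c; apply: tperm_stable.
move: yP; rewrite !inE stabC => /andP[-> /=].
by rewrite strict_min_relabel ?tpermR // => c; apply: tperm_stable.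
Qed.

(** The [#|W|] events of being the strict minimum are disjoint and, by symmetry, equally likely. *)
Lemma card_strict_min_le W a : a \in W ->
  #|W| * #|[set x | strict_min x a W]| <= #|{: label}|.
Proof.
move=> aW; rewrite -sum_nat_const.
rewrite (eq_bigr (fun b => #|[set x | strict_min x b W]|)); last first.
  move=> b bW; have := @card_strict_min_eq setT W a b aW bW.
  have e c : [set x in setT | strict_min x c W] = [set x | strict_min x c W].
    by apply/setP => x; rewrite !inE.
  by rewrite !e => -> // x; rewrite !inE.
rewrite sum_card_swap -sum1_card; apply: leq_sum => x _.
apply/card_le1_eqP => b c; rewrite !inE => /andP[bW /strict_minP hb].
case/andP=> cW /strict_minP hc; apply/eqP; apply: contraT => bc.
have := hb c cW bc; rewrite eq_sym in bc; have := hc b bW bc; lia.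
Qed.

(** Outside [ties W] some element of [W] is the strict minimum, and by symmetry all are equally
    likely within the invariant event [C]. *)
Lemma card_strict_min_ge C W a : a \in W ->
    (forall b x, b \in W -> (relabel (tperm a b) x \in C) = (x \in C)) ->
  #|C| <= #|W| * #|[set x in C | strict_min x a W]| + #|ties W|.
Proof.
move=> aW stabC; rewrite -sum_nat_const.
rewrite (eq_bigr (fun b => #|[set x in C | strict_min x b W]|)); last first.
  by move=> b bW; apply: card_strict_min_eq => // x; apply: stabC.
have sub : C \subset \bigcup_(b in W) [set x in C | strict_min x b W] :|: ties W.
  apply/subsetP => x xC; rewrite inE orbC; apply/orP.
  case: (boolP (x \in ties W)) => [|nt]; [by left|right].
  case: (arg_minnP (fun b => x b : nat) aW) => b bW leb.
  apply/bigcupP; exists b => //; rewrite inE xC; apply/strict_minP => c cW cb.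
  rewrite ltn_neqAle leb // andbT; apply: contraNneq nt => eqx.
  rewrite inE; apply/exists_inP; exists c => //; apply/exists_inP; exists b => //.
  by rewrite cb; apply/eqP/val_inj.
apply: leq_trans (subset_leq_card sub) _.
by apply: leq_trans (leq_card_setU _ _) _; rewrite leq_add2r card_bigcup_le.
Qed.

Lemma card_ties Z : M * #|ties Z| <= #|Z| ^ 2 * #|{: label}|.
Proof.
have pair a b : a != b -> M * #|[set x : label | x a == x b]| <= #|{: label}|.
  move=> ab; rewrite -[X in X * _]card_ord -cardsT mulnC -cardsX.
  (* Overwriting the label of [a] by an arbitrary value is injective on outcomes with [x a = x b],
     since the lost label is still present at [b]. *)
  rewrite -(@card_in_imset _ _ (fun p => upd p.1 a p.2)) ?max_card //.
  case=> [x m] [y n]; rewrite !inE !andbT /= => /eqP ex /eqP ey /ffunP e.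
  have em : m = n by have := e a; rewrite !ffunE eqxx.
  congr (_, _) => //; apply/ffunP => c; have := e c; rewrite !ffunE.
  case: eqP => [-> _|//]; rewrite ex ey.
  by have := e b; rewrite !ffunE eq_sym (negbTE ab).
have sub : ties Z \subset \bigcup_(p in setX Z Z | p.1 != p.2)
    [set x : label | x p.1 == x p.2].
  apply/subsetP => x; rewrite inE => /exists_inP[a aZ /exists_inP[b bZ /andP[ab xab]]].
  by apply/bigcupP; exists (a, b); rewrite ?inE /= ?aZ ?bZ.
apply: (@leq_trans (\sum_(p in setX Z Z | p.1 != p.2) #|{: label}|)).
  apply: (@leq_trans (M * \sum_(p in setX Z Z | p.1 != p.2)
      #|[set x : label | x p.1 == x p.2]|)).
    rewrite leq_mul2l; apply/orP; right.
    apply: leq_trans (subset_leq_card sub) _; exact: card_bigcup_le.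
  by rewrite big_distrr; apply: leq_sum => p /andP[_]; apply: pair.
rewrite sum_nat_const leq_mul2r; apply/orP; right.
rewrite expnS expn1 -cardsX; apply: subset_leq_card; apply/subsetP => p.
by case/andP.
Qed.

(* Up to ties, [a] is the minimum of [U] and [b] that of [W] with probability
   [1 / (#|U| #|W|)]: since [a] is not in [W], the two events are independent. *)
Lemma card_strict_min2 W U a b : W \subset U -> a \in U :\: W -> b \in W ->
  #|{: label}| <= #|U| * (#|W| * #|[set x | strict_min x a U && strict_min x b W]|)
    + (#|U| + 1) * #|ties U|.
Proof.
move=> sWU; rewrite inE => /andP[aW aU] bW.
have h1 : #|{: label}| <= #|U| * #|[set x | strict_min x a U]| + #|ties U|.
  have := @card_strict_min_ge setT U a aU; rewrite cardsT.
  have -> : [set x in setT | strict_min x a U] = [set x | strict_min x a U].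
    by apply/setP => x; rewrite !inE.
  by apply => c x _; rewrite !inE.
have h2 : #|[set x | strict_min x a U]| <=
    #|W| * #|[set x | strict_min x a U && strict_min x b W]| + #|ties U|.
  have -> : [set x | strict_min x a U && strict_min x b W] =
      [set x in [set x | strict_min x a U] | strict_min x b W].
    by apply/setP => x; rewrite !inE.
  apply: leq_trans (@card_strict_min_ge _ W b bW _) _; last first.
    by rewrite leq_add2l ties_leS.
  move=> c x cW; rewrite !inE strict_min_relabel ?tpermD //.
  - by apply: contraNneq aW => <-.
  - by apply: contraNneq aW => <-.
  - by move=> z; apply: tperm_stable; apply: (subsetP sWU).
apply: leq_trans h1 _; rewrite mulnDl mul1n addnA leq_add2r -mulnDr.
by rewrite leq_mul2l h2 orbT.
Qed.
End Labels.

(** * Selecting a matching for one color, and the chance that a neighborhood is missed *)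

Section Selection.
Variables (V E : finType) (es : E -> {set V}) (A : {set E}) (T M : nat).
Notation index := (E * option 'I_T)%type.
Notation label := {ffun index -> 'I_M}.
Notation nbhd := (closed_nbhd es A).
Implicit Types (x : label) (e f g : E).

(* The labels [(f, Some j)] are private to [f]; they pad the number of labels
   that [f] has to beat so that every edge is selected equally often. *)
Definition rivals f : {set index} :=
  [set b : index | if b.2 is Some j then (b.1 == f) && (j < T - #|nbhd f|)
           else b.1 \in nbhd f].

Definition selected x f := (f \in A) && strict_min x (f, None) (rivals f).

Lemma card_ord_lt n (m : nat) : m <= n -> #|[set i : 'I_n | i < m]| = m.
Proof.
move=> le_mn; rewrite -[RHS]card_ord -!sum1_card (big_ord_widen _ (fun=> 1) le_mn).
by apply: eq_bigl => i; rewrite inE.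
Qed.

Lemma rivalsE f : rivals f = [set (g, None) | g in nbhd f]
  :|: [set (f, Some j) | j in [set j : 'I_T | j < T - #|nbhd f|]].
Proof.
apply/setP => -[g [j|]]; rewrite !inE /=.
  have -> : ((g, Some j) \in [set (g, None : option 'I_T) | g in nbhd f]) = false.
    by apply/imsetP => -[].
  apply/andP/imsetP => [[/eqP-> ltj]|[i]]; first by exists j; rewrite ?inE.
  by rewrite inE => lti [-> ->]; rewrite eqxx.
have -> : ((g, None) \in [set (f, Some j) | j in [set j : 'I_T | j < T - #|nbhd f|]]) = false.
  by apply/imsetP => -[].
rewrite orbF; apply/idP/imsetP => [gf|[h hf [->]]]; last by move: hf; rewrite inE.
by exists g; rewrite ?inE.
Qed.

Lemma card_rivals f : #|nbhd f| <= T -> #|rivals f| = T.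
Proof.
move=> leT; rewrite rivalsE cardsU disjoint_setI0 ?cards0 ?subn0; last first.
  apply/pred0P => -[g o] /=; apply/andP => -[/imsetP[h _ [_ ->]] /imsetP[]] //.
rewrite !card_imset ?card_ord_lt ?leq_subr ?subnKC //; by move=> a b [].
Qed.

Hypothesis nonempty : forall f, f \in A -> 0 < #|es f|.
Hypothesis nbhd_le : forall f, f \in A -> #|nbhd f| <= T.

Lemma nbhd_refl f : f \in A -> f \in nbhd f.
Proof. by move=> fA; rewrite inE fA /meets setIid -card_gt0 nonempty. Qed.

Lemma rivals_refl f : f \in A -> (f, None) \in rivals f.
Proof. by move=> fA; have := nbhd_refl fA; rewrite !inE. Qed.

(** Intersecting edges are rivals of each other, so the edges selected for one color form a
    matching. *)
Lemma selected_disjoint x f g : f != g -> selected x f -> selected x g ->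
  ~~ meets es f g.
Proof.
move=> fg /andP[fA /strict_minP hf] /andP[gA /strict_minP hg].
apply/negP => mfg.
have := hf (g, None); rewrite !inE /= gA mfg => /(_ isT).
have := hg (f, None); rewrite !inE /= fA meetsC mfg => /(_ isT).
rewrite !xpair_eqE !andbT [g == f]eq_sym => /(_ fg) lt1 /(_ fg) lt2.
by have := ltn_trans lt1 lt2; rewrite ltnn.
Qed.

Lemma card_selected_le f : T * #|[set x | selected x f]| <= #|{: label}|.
Proof.
have [fA|fA] := boolP (f \in A); last first.
  rewrite (_ : [set x | _] = set0) ?cards0 ?muln0 //.
  by apply/setP => x; rewrite !inE /selected (negbTE fA).
have := card_strict_min_le M (rivals_refl fA); rewrite card_rivals ?nbhd_le //.
by rewrite /selected fA.
Qed.

Section Probability.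
Local Open Scope ring_scope.
Variables (R : realFieldType) (eta : R) (k : nat).
Hypothesis eta01 : 0 < eta < 1.
Hypothesis M_large : 36 * T%:R ^+ 3 <= eta * M%:R.
Hypothesis T_gt0 : (0 < T)%N.

Let N : R := #|{: label}|%:R.

Let M_gt0 : 0 < M%:R :> R.
Proof.
have /andP[eta0 _] := eta01; rewrite -(pmulr_rgt0 _ eta0).
by apply: lt_le_trans M_large; rewrite mulr_gt0 ?exprn_gt0 ?ltr0n.
Qed.

Let N_gt0 : 0 < N.
Proof. by rewrite ltr0n card_ffun expn_gt0 card_ord -(ltr0n R) M_gt0. Qed.

Lemma ties_rare (b c : nat) (Z : {set index}) : (#|Z| <= c)%N ->
  b%:R * c%:R ^+ 2 <= eta * M%:R -> b%:R * #|ties M Z|%:R <= eta * N.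
Proof.
move=> Zc bc; rewrite -(ler_pM2r M_gt0).
have h : M%:R * #|ties M Z|%:R <= c%:R ^+ 2 * N.
  rewrite -natrX -!natrM ler_nat; apply: leq_trans (card_ties M Z) _.
  by rewrite leq_mul2r leq_exp2r ?Zc ?orbT.
apply: (@le_trans _ _ (b%:R * (c%:R ^+ 2 * N))).
  by rewrite -mulrA ler_wpM2l ?ler0n // mulrC.
by rewrite mulrA [leRHS]mulrAC ler_wpM2r // ltW.
Qed.

(** Every edge has exactly [T] rivals, so its selection probability is [1 / T] up to ties; this is
    the counterpart of [card_selected_le]. *)
Lemma selected_ge f : f \in A ->
  (1 - eta) * N <= T%:R * #|[set x | selected x f]|%:R.
Proof.
move=> fA.
have stab b x : b \in rivals f ->
    (relabel (tperm (f, None) b) x \in [set: label]) = (x \in [set: label]).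
  by rewrite !inE.
have := card_strict_min_ge (rivals_refl fA) stab.
have e : [set x in setT | strict_min x (f, None) (rivals f)] = [set x | selected x f].
  by apply/setP => x; rewrite !inE /selected fA.
rewrite e card_rivals ?nbhd_le // cardsT => h.
have {h} : N <= T%:R * #|[set x | selected x f]|%:R + #|ties M (rivals f)|%:R.
  by rewrite -natrM -natrD ler_nat h.
have := @ties_rare 1 T (rivals f); rewrite card_rivals ?nbhd_le // => /(_ (leqnn _)).
rewrite !mul1r => h.
have /h : T%:R ^+ 2 <= eta * M%:R; last by lra.
apply: le_trans M_large; rewrite exprS mulrA ler_peMl ?sqr_ge0 //.
by have : 1 <= T%:R :> R; [rewrite ler1n | lra].
Qed.

Section Unhit.
Variables (e : E) (eA : e \in A).
Let F := nbhd e.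
Let r g := #|nbhd g :&: F|.
Let U g f : {set index} := rivals g :|: rivals f :|: [set (u, None) | u in F].
Let pairing g f : {set label} :=
  [set x | strict_min x (f, None) (U g f) && strict_min x (g, None) (rivals g)].

Let inA g : g \in F -> g \in A.
Proof. by rewrite inE => /andP[]. Qed.

(** Each of the two rival sets has [T] elements, and the labels of the common neighbors counted by
    [r] already belong to [F]. *)
Lemma card_union_rivals g f : g \in F -> f \in F ->
  (#|U g f| + r g + r f <= #|F| + 2 * T)%N.
Proof.
move=> gF fF; pose F' : {set index} := [set (u, None) | u in F].
have cF' : #|F'| = #|F| by rewrite card_imset // => a b [].
have outside h : h \in F -> (#|rivals h :\: F'| + r h <= T)%N.
  move=> hF; rewrite -[X in (_ <= X)%N](card_rivals (nbhd_le (inA hF))).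
  rewrite -(cardsID F' (rivals h)) addnC leq_add2r.
  have <- : #|[set (u, None : option 'I_T) | u in nbhd h :&: F]| = r h.
    by rewrite card_imset // => a b [].
  apply: subset_leq_card; apply/subsetP => _ /imsetP[u uI ->].
  by move: uI; rewrite inE => /andP[uh uF]; rewrite inE inE /= uh imset_f.
have sub : U g f \subset F' :|: (rivals g :\: F' :|: rivals f :\: F').
  apply/subsetP => b; rewrite !in_setU !in_setD -/F'.
  by case: (b \in F'); case: (b \in rivals g); case: (b \in rivals f).
have := subset_leq_card sub; have /leq_of_leqif := leq_card_setU F' (rivals g :\: F' :|: rivals f :\: F').
have /leq_of_leqif := leq_card_setU (rivals g :\: F') (rivals f :\: F').
have := outside g gF; have := outside f fF; rewrite cF'; clear; lia.
Qed.

(** As [f] does not meet [g], its label is not among the rivals of [g], so [card_strict_min2]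
    applies. *)
Lemma pairing_ge g f : g \in F -> f \in F -> f \notin nbhd g ->
  (1 - eta) * N <= #|U g f|%:R * T%:R * #|pairing g f|%:R.
Proof.
move=> gF fF fg; have gA := inA gF; have fA := inA fF.
have sU : rivals g \subset U g f by rewrite /U -setUA subsetUl.
have fU : (f, None) \in U g f :\: rivals g.
  by rewrite in_setD !in_setU rivals_refl // orbT andbT inE.
have := @card_strict_min2 _ M _ _ _ _ sU fU (rivals_refl gA).
rewrite card_rivals ?nbhd_le // -(ler_nat R) natrD mulnA 3!natrM -/(pairing g f).
have U3 : (#|U g f| <= 3 * T)%N.
  by have := card_union_rivals gF fF; have := nbhd_le eA; rewrite -/F; clear; lia.
have := @ties_rare (#|U g f| + 1)%N (3 * T)%N _ U3; rewrite -/N.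
move=> h; have {}h : (#|U g f| + 1)%N%:R * #|ties M (U g f)|%:R <= eta * N.
  apply: h; apply: le_trans M_large.
  (* Source of the constant 36: ties among at most [3 T] labels are weighted by
     [#|U g f| + 1 <= 4 T]. *)
  have -> : 36 * T%:R ^+ 3 = (4 * T)%N%:R * (3 * T)%N%:R ^+ 2 :> R.
    by rewrite !natrM; ring.
  rewrite ler_wpM2r ?sqr_ge0 // ler_nat.
  by move: U3 T_gt0; clear; lia.
lra.
Qed.

(* If [X >= 1] edges of [F] are selected, at most [X - 1] of them have a label
   exceeding that of another selected edge of [F]; the edge [f] in a [pairing g f]
   is unique because it also beats all of [F]. *)
Lemma hit_count : (#|[set x | [exists f in F, selected x f]]|
   + \sum_(g in F) \sum_(f in F :\: nbhd g) #|pairing g f|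
   <= \sum_(g in F) #|[set x | selected x g]|)%N.
Proof.
rewrite sum_card_swap (eq_bigr (fun g =>
  \sum_x #|[set f | (f \in F :\: nbhd g) && (x \in pairing g f)]|)%N); last first.
  move=> g _; rewrite -sum_card_swap; apply: eq_bigr => f _.
  by apply: eq_card => x; rewrite inE.
rewrite exchange_big -sum1_card big_mkcond -big_split; apply: leq_sum => x _ /=.
set S := [set g | (g \in F) && selected x g].
have SE h : (h \in S) = (h \in F) && selected x h by rewrite in_set.
pose P g := [set f | (f \in F :\: nbhd g) && (x \in pairing g f)].
have sel g f : g \in F -> f \in P g -> [/\ f \in S, g \in S & x (f, None) < x (g, None)]%N.
  move=> gF; rewrite in_set in_setD => /andP[/andP[fg fF]].
  rewrite in_set => /andP[mf mg].
  have mf' : strict_min x (f, None) (rivals f).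
    apply: strict_minS mf.
    exact: subset_trans (subsetUr (rivals g) _) (subsetUl _ _).
  rewrite !SE fF gF /selected !inA //=.
  rewrite mf' mg; split=> //; move/strict_minP: mf; apply.
    by rewrite !in_setU rivals_refl ?inA.
  rewrite xpair_eqE andbT; apply: contraNneq fg => <-.
  by apply: nbhd_refl; apply: inA.
have P1 g : g \in F -> (#|P g| <= (g \in S))%N.
  move=> gF; have [->|/set0Pn[f fP]] := eqVneq (P g) set0; first by rewrite cards0.
  have [_ -> _] := sel g f gF fP; apply/card_le1_eqP => f1 f2.
  rewrite [f1 \in _]in_set [f2 \in _]in_set !in_setD [x \in _]in_set [x \in pairing _ f2]in_set => /andP[/andP[_ f1F] /andP[/strict_minP h1 _]].
  case/andP => /andP[_ f2F] /andP[/strict_minP h2 _].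
  apply/eqP; apply: contraT => f12.
  have i1 : (f1, None) \in U g f2 by rewrite in_setU imset_f ?orbT.
  have i2 : (f2, None) \in U g f1 by rewrite in_setU imset_f ?orbT.
  have := h1 _ i2; have := h2 _ i1; rewrite !xpair_eqE !andbT f12 eq_sym f12.
  by move=> /(_ isT) l1 /(_ isT) l2; have := ltn_trans l1 l2; rewrite ltnn.
rewrite in_set; have [S0|/set0Pn[g1 g1S]] := eqVneq S set0.
  case: exists_inP => [[f fF sf]|_]; first by have := in_set0 f; rewrite -S0 in_set fF sf.
  rewrite S0 cards0 big1 // => g gF; have := P1 g gF; rewrite S0 inE.
  by rewrite leqn0 => /eqP.
(* The selected edge [g0] of least label has no smaller partner; its unit in the sum pays for the
   event that [F] is hit. *)
case: (arg_minnP (fun g => x (g, None) : nat) g1S) => g0 g0S min0.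
have {}g0S : g0 \in S by [].
have g0F : g0 \in F by move: g0S; rewrite SE => /andP[].
rewrite (cardsD1 g0) g0S (bigD1 g0) //=.
have -> : #|[set f | (f \in F :\: nbhd g0) && (x \in pairing g0 f)]| = 0%N.
  apply: eq_card0 => f; apply/negP => fP; have [fS _ lt] := sel g0 f g0F fP.
  by have := min0 f fS; rewrite leqNgt lt.
rewrite add0n; apply: leq_add; first by case: ifP.
apply: (@leq_trans (\sum_(g in F | g != g0) (g \in S))).
  by apply: leq_sum => g /andP[gF _]; apply: P1.
rewrite -sum1_card [leqRHS]big_mkcond [leqLHS]big_mkcond /=; apply: leq_sum => g _.
rewrite in_setD1 andbC; case: (g != g0); rewrite ?andbF ?andbT //=.
by case: (g \in F); case: (g \in S).
Qed.

Section Gain.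
Variable D : nat.
Hypothesis k_ge2 : (2 <= k)%N.
Hypothesis unif : forall f, f \in A -> #|es f| = k.
Hypothesis star_le : forall v, (#|star es A v| <= D)%N.
Hypothesis TE : T = (k * D)%N.

Let rT := T%:R : R.
Let K2 : 2 <= k%:R :> R. Proof. by rewrite ler_nat. Qed.
Let T0 : 0 < rT. Proof. by rewrite ltr0n. Qed.
Let nu g : R := (rT - (r g)%:R) / rT.
(** The cap brings the argument into the range of [inv_le_hyp_weights]; it takes effect when
    [r g < D]. *)
Let cap g : R := Num.min (nu g) (1 - k%:R^-1).
Let w g : R := (2 + slope k%:R * cap g)^-1.

Let rle g : g \in F -> (r g)%:R <= rT.
Proof.
move=> gF; rewrite ler_nat; apply: leq_trans (nbhd_le (inA gF)).
exact/subset_leq_card/subsetIl.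
Qed.

Let nuT g : nu g * rT = rT - (r g)%:R.
Proof. by rewrite divfK ?gt_eqF. Qed.

Let cap_in g : g \in F -> 0 <= cap g <= 1 - k%:R^-1.
Proof.
move=> gF; rewrite ge_min lexx orbT andbT le_min; apply/andP; split.
  by rewrite divr_ge0 ?subr_ge0 ?rle // ltW.
by have := K2; rewrite subr_ge0 => ?; rewrite invf_le1; lra.
Qed.

(** If no cap is active this is [card_union_rivals] with [#|F| <= T]. An active cap replaces the
    count for one edge by [card_closed_nbhd_le1], and two active caps use [card_closed_nbhd_le2],
    which needs [f] and [g] disjoint. *)
Lemma card_union_rivals_cap g f : g \in F -> f \in F -> f \notin nbhd g ->
  #|U g f|%:R <= rT * (1 + cap f + cap g).
Proof.
move=> gF fF fg; have K0 : 0 < k%:R :> R by have := K2; lra.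
have nfg : ~~ meets es f g.
  by move: fg; rewrite inE (inA fF) /= meetsC.
have := card_closed_nbhd_le1 unif star_le eA gF.
have := card_closed_nbhd_le1 unif star_le eA fF.
have := card_closed_nbhd_le2 unif star_le eA fF gF nfg.
have := card_union_rivals gF fF; rewrite -/F -/(r f) -/(r g).
rewrite -!(ler_nat R) !natrD !natrM !natrB //; last exact: ltnW.
have nT : #|F|%:R <= rT by rewrite ler_nat nbhd_le.
have TK : rT = k%:R * D%:R by rewrite /rT TE natrM.
have q : rT * (1 - k%:R^-1) = rT - D%:R by rewrite TK; field; rewrite gt_eqF.
have := nuT f; have := nuT g; rewrite -/rT => nuf nug h0 h1 h2 h3.
rewrite 2!mulrDr mulr1 /cap.
have [c1|c1] := leP (nu f) (1 - k%:R^-1);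
  have [c2|c2] := leP (nu g) (1 - k%:R^-1); rewrite ?q; lra.
Qed.

(** The bound in terms of [1 / (1 + cap f + cap g)] is split into a sum of one weight per edge, so
    that pairs can be summed edge by edge. *)
Lemma pairing_ge_weights g f : g \in F -> f \in F -> f \notin nbhd g ->
  (1 - eta) * N / (2 * rT ^+ 2) * (w f + w g) <= #|pairing g f|%:R.
Proof.
move=> gF fF fg; have := pairing_ge gF fF fg.
have cU := card_union_rivals_cap gF fF fg.
have := inv_le_hyp_weights K2 (cap_in fF) (cap_in gF); rewrite -/(w f) -/(w g).
have /andP[f0 _] := cap_in fF; have /andP[g0 _] := cap_in gF.
rewrite ler_pdivlMr; last by lra.
have eN : 0 <= (1 - eta) * N.
  by rewrite mulr_ge0 ?(ltW N_gt0) // subr_ge0 ltW //; case/andP: eta01.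
have T20 : 0 < rT ^+ 2 by rewrite exprn_gt0.
move: ((1 - eta) * N) eN => X X0 hw hX; rewrite -(@ler_pM2r _ (2 * rT ^+ 2)).
  rewrite mulrAC divfK ?gt_eqF //; last by rewrite mulr_gt0.
  have p0 : 0 <= #|pairing g f|%:R :> R by [].
  apply: le_trans (_ : (#|pairing g f|%:R * (rT ^+ 2 * (1 + cap f + cap g)))
     * (w f + w g) <= _).
    rewrite ler_wpM2r //.
      by rewrite addr_ge0 // invr_ge0 ltW // hyp_den_gt0.
    apply: le_trans hX _; rewrite mulrC ler_wpM2l // expr2 -mulrA mulrC.
    by rewrite ler_wpM2l // ltW.
  rewrite -mulrA ler_wpM2l // -mulrA [leRHS]mulrC ler_wpM2l ?(ltW T20) //.
  by rewrite mulrC.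
by rewrite mulr_gt0.
Qed.

Lemma sum_weights_swap :
  \sum_(g in F) \sum_(f in F :\: nbhd g) (w f + w g) =
  2 * \sum_(g in F) (#|F|%:R - (r g)%:R) * w g.
Proof.
have -> : \sum_(g in F) \sum_(f in F :\: nbhd g) (w f + w g) =
    \sum_(g in F) \sum_(f in F :\: nbhd g) w f
    + \sum_(g in F) \sum_(f in F :\: nbhd g) w g.
  by rewrite -big_split; apply: eq_bigr => g _; rewrite big_split.
have -> : \sum_(g in F) \sum_(f in F :\: nbhd g) w f =
    \sum_(g in F) \sum_(f in F :\: nbhd g) w g.
  rewrite [LHS](exchange_big_dep (mem F)) /=; last first.
    by move=> g f _; rewrite in_setD => /andP[].
  apply: eq_bigr => f fF; apply: eq_bigl => g; rewrite !in_setD fF andbT andbC.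
  case gF : (g \in F); rewrite ?andbF //= ?andbT !inE.
  by rewrite (inA fF) (inA gF) meetsC.
rewrite -mulr2n mulr_natl; congr (_ *+ _); apply: eq_bigr => g gF.
rewrite sumr_const -[LHS]mulr_natl; congr (_ * _).
by rewrite -(cardsID (nbhd g) F) setIC natrD addrC addKr.
Qed.

Lemma unhit_ge : (1 - eta) * gain k%:R * N <=
  #|[set x | [forall f in F, ~~ selected x f]]|%:R.
Proof.
have D_gt0 : (0 < D)%N by move: T_gt0; rewrite TE muln_gt0 => /andP[].
have := hyp_sum_closed_nbhd k_ge2 unif star_le eA R D_gt0.
rewrite -/F -TE -/rT => hsum.
have K0 : 0 < k%:R :> R by have := K2; lra.
have nT : #|F|%:R <= rT by rewrite ler_nat nbhd_le.
have [eta0 eta1] := andP eta01.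
have hitC : #|[set x | [forall f in F, ~~ selected x f]]|%:R =
    N - #|[set x | [exists f in F, selected x f]]|%:R.
  rewrite /N -(cardsC [set x | [exists f in F, selected x f]]) natrD addrC addKr.
  by congr _%:R; apply: eq_card => x; rewrite !inE negb_exists_in.
have hit := hit_count; rewrite -(ler_nat R) natrD !natr_sum in hit.
have selle : \sum_(g in F) #|[set x | selected x g]|%:R <= #|F|%:R * N / rT.
  rewrite -mulrA mulr_natl -sumr_const; apply: ler_sum => g _.
  by rewrite ler_pdivlMr // mulrC -natrM ler_nat card_selected_le.
have pairle : (1 - eta) * N / rT ^+ 2 * \sum_(g in F) (#|F|%:R - (r g)%:R) * w g <=
    \sum_(g in F) (\sum_(f in F :\: nbhd g) #|pairing g f|)%:R.
  apply: (@le_trans _ _ (\sum_(g in F) \sum_(f in F :\: nbhd g)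
     (1 - eta) * N / (2 * rT ^+ 2) * (w f + w g))); last first.
    apply: ler_sum => g gF; rewrite natr_sum; apply: ler_sum => f.
    by rewrite in_setD => /andP[fg fF]; apply: pairing_ge_weights.
  rewrite le_eqVlt; apply/orP; left; apply/eqP.
  rewrite [RHS](eq_bigr (fun g => (1 - eta) * N / (2 * rT ^+ 2) *
     \sum_(f in F :\: nbhd g) (w f + w g))); last by move=> g _; rewrite mulr_sumr.
  rewrite -mulr_sumr sum_weights_swap mulrA; congr (_ * _).
  by field; rewrite gt_eqF.
(* Write [#|F| - r g] as [(T - r g) - (T - #|F|)]: the first part gives [hyp], and in the second the
   weight is at most [1 / 2]. *)
have wle : \sum_(g in F) hyp k%:R (nu g) * rT - #|F|%:R * ((rT - #|F|%:R) / 2)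
    <= \sum_(g in F) (#|F|%:R - (r g)%:R) * w g.
  rewrite mulr_natl -sumr_const -sumrB; apply: ler_sum => g gF.
  have nu0 : 0 <= nu g by rewrite divr_ge0 ?subr_ge0 ?rle // ltW.
  have /andP[c0 _] := cap_in gF.
  have rF : (r g)%:R <= #|F|%:R :> R by rewrite ler_nat subset_leq_card ?subsetIr.
  have den := hyp_den_gt0 K2 nu0; have s0 := slope_ge0 K2.
  apply: (@le_trans _ _ ((#|F|%:R - (r g)%:R) / (2 + slope k%:R * nu g))); last first.
    rewrite ler_wpM2l ?subr_ge0 // lef_pV2 ?posrE ?hyp_den_gt0 //.
    by rewrite lerD2l ler_wpM2l // ge_min lexx.
  rewrite /hyp mulrAC nuT.
  have -> : #|F|%:R - (r g)%:R = (rT - (r g)%:R) - (rT - #|F|%:R) by ring.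
  rewrite [leRHS]mulrBl lerB // ler_wpM2l ?subr_ge0 // lef_pV2 ?posrE //.
  by rewrite lerDl mulr_ge0.
have {wle}wle : rT * (\sum_(g in F) hyp k%:R (nu g) - (rT - #|F|%:R) / 2) <=
    \sum_(g in F) (#|F|%:R - (r g)%:R) * w g.
  apply: le_trans wle; rewrite -mulr_suml mulrBr [rT * _]mulrC lerB //.
  by rewrite ler_wpM2r // divr_ge0 // subr_ge0.
rewrite hitC.
set H := #|_|%:R in hit *; set Q := \sum_(g in F) (_ - _) * _ in pairle wle.
set Y := \sum_(g in F) hyp _ _ in hsum wle.
set n : R := #|F|%:R in hsum nT selle wle.
have c0 : 0 <= (1 - eta) * N / rT ^+ 2.
  by rewrite divr_ge0 ?mulr_ge0 ?subr_ge0 ?exprn_ge0 ?(ltW N_gt0) ?(ltW eta1) // ltW.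
have : (1 - eta) * N / rT ^+ 2 * (rT * (Y - (rT - n) / 2)) <= n * N / rT - H.
  apply: le_trans (ler_wpM2l c0 wle) _.
  by apply: le_trans pairle _; lra.
have -> : (1 - eta) * N / rT ^+ 2 * (rT * (Y - (rT - n) / 2)) =
    (1 - eta) * N / rT * (Y - (rT - n) / 2).
  by field; rewrite gt_eqF.
(* The surplus [N (T - n) / T], present because [F] has only [n <= T] edges, turns [- (T - n) / 2]
   into the [+ (T - n) / 2] required by [hsum]. *)
move=> main; apply: (@le_trans _ _ ((1 - eta) * N / rT * ((rT - n) / 2 + Y))).
  rewrite [leRHS]mulrAC ler_pdivlMr // [leLHS]mulrC mulrA mulrC.
  rewrite [leLHS](_ : _ = (1 - eta) * N * (rT * gain k%:R)); last by ring.
  by rewrite ler_wpM2l // mulr_ge0 ?subr_ge0 ?(ltW N_gt0) // ltW.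
have : N * ((rT - n) / rT) = N - n * N / rT by field; rewrite gt_eqF.
have : (1 - eta) * N / rT * (rT - n) <= N * ((rT - n) / rT).
  have z0 : 0 <= N * ((rT - n) / rT).
    by rewrite mulr_ge0 ?(ltW N_gt0) // divr_ge0 ?subr_ge0 // ltW.
  have -> : (1 - eta) * N / rT * (rT - n) = (1 - eta) * (N * ((rT - n) / rT)).
    by field; rewrite gt_eqF.
  by rewrite ler_piMl //; lra.
move: main; set G := (1 - eta) * N / rT; lra.
Qed.
End Gain.
End Unhit.
End Probability.
End Selection.

(** * Means over independent coordinates *)

Section MeanProd.
Local Open Scope ring_scope.
Variables (R : realType) (K W : finType).

Lemma mean_prod (g : K -> W -> R) :
  mean (fun w : {ffun K -> W} => \prod_c g c (w c)) = \prod_c mean (g c).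
Proof.
rewrite /mean -bigA_distr_bigA big_split /= prodfV; congr (_ * _^-1).
by rewrite card_ffun natrX -prodr_const.
Qed.

Lemma mean_marginal (c : K) (G : W -> R) : (0 < #|W|)%N ->
  mean (fun w : {ffun K -> W} => G (w c)) = mean G.
Proof.
move=> W_gt0; pose g c' := if c' == c then G else fun=> 1.
transitivity (mean (fun w : {ffun K -> W} => \prod_c' g c' (w c'))).
  congr (_ / _); apply: eq_bigr => w _; rewrite (bigD1 c) //= /g eqxx big1 ?mulr1 //.
  by move=> c' /negbTE->.
rewrite mean_prod (bigD1 c) //= /g eqxx big1 ?mulr1 // => c' /negbTE->.
exact: mean_cst.
Qed.

Lemma mean_indicator (T : finType) (P : pred T) :
  mean (fun w => (P w)%:R : R) = #|[set w | P w]|%:R / #|T|%:R.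
Proof.
congr (_ / _); rewrite -natr_sum; congr _%:R.
rewrite -sum1_card [RHS]big_mkcond; apply: eq_bigr => w _.
by rewrite inE; case: (P w).
Qed.
End MeanProd.

(** * Coloring with one batch of colors *)

Section Batch.
Variables (V E K : finType) (es : E -> {set V}) (k D l M : nat).
Variables (A : {set E}) (L : E -> {set K}).
Hypothesis k_ge2 : 2 <= k.
Hypothesis D_gt0 : 0 < D.
Hypothesis unif : forall f, f \in A -> #|es f| = k.
Hypothesis star_le : forall v, #|star es A v| <= D.
Hypothesis L_ge : forall f, f \in A -> l <= #|L f|.
Let T := k * D.
Notation index := (E * option 'I_T)%type.
Notation label := {ffun index -> 'I_M}.
Notation outcome := {ffun K -> label}.
Implicit Types (w : outcome) (c : K) (e f g : E) (x : V).

Definition color_graph c : {set E} := [set f in A | c \in L f].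
Definition takes w c f := selected es (color_graph c) (w c) f.
Definition uncolored w : {set E} := [set f in A | [forall c in L f, ~~ takes w c f]].
(** An edge may take several colors although it will use only one, and every taken color is
    discarded around it. The loss of [c] thus depends on the labels [w c] alone. *)
Definition kept w e : {set K} :=
  [set c in L e | [forall f in closed_nbhd es (color_graph c) e, ~~ takes w c f]].

Let sub_graph c f : f \in color_graph c -> f \in A.
Proof. by rewrite inE => /andP[]. Qed.

Let unif_graph c f : f \in color_graph c -> #|es f| = k.
Proof. by move/sub_graph/unif. Qed.

Let star_graph c v : #|star es (color_graph c) v| <= D.
Proof.
apply: leq_trans (star_le v); apply/subset_leq_card/subsetP => f.
by rewrite !inE => /andP[/andP[-> _] ->].
Qed.

Let nonempty_graph c f : f \in color_graph c -> 0 < #|es f|.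
Proof. by move/unif_graph->; lia. Qed.

Let nbhd_graph c f : f \in color_graph c -> #|closed_nbhd es (color_graph c) f| <= T.
Proof. by move=> fc; apply: card_closed_nbhd fc; [apply: unif_graph | apply: star_graph]. Qed.

Lemma takes_disjoint w c f g : f != g -> takes w c f -> takes w c g -> ~~ meets es f g.
Proof. exact: selected_disjoint. Qed.

Lemma takes_star w c x f g : takes w c f -> takes w c g ->
  x \in es f -> x \in es g -> f = g.
Proof.
move=> tf tg xf xg; apply/eqP; apply: contraT => fg.
case/negP: (takes_disjoint fg tf tg).
by apply/meets_exP; exists x.
Qed.

Section Means.
Local Open Scope ring_scope.
Variables (R : realType) (eta : R).
Hypothesis eta01 : 0 < eta < 1.
Hypothesis M_large : 36 * T%:R ^+ 3 <= eta * M%:R.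

Let T_gt0 : (0 < T)%N. Proof. by rewrite /T; lia. Qed.
Let T0 : 0 < T%:R :> R. Proof. by rewrite ltr0n. Qed.
Let M_gt0 : (0 < M)%N.
Proof.
have /andP[eta0 _] := eta01; rewrite -(ltr0n R) -(pmulr_rgt0 _ eta0).
by apply: lt_le_trans M_large; rewrite mulr_gt0 ?exprn_gt0.
Qed.

Lemma label_gt0 : (0 < #|{: label}|)%N.
Proof. by rewrite card_ffun expn_gt0 card_ord M_gt0. Qed.

Let label0 : 0 < #|{: label}|%:R :> R.
Proof. by rewrite ltr0n label_gt0. Qed.

Let rate : R := (1 - eta) / T%:R.

Lemma rate_ge0 : 0 <= rate.
Proof. by rewrite divr_ge0 ?ler0n //; have := eta01; lra. Qed.

Lemma rate_le1 : rate <= 1.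
Proof.
have : 1 <= T%:R :> R by rewrite ler1n.
by rewrite ler_pdivrMr // mul1r; have := eta01; lra.
Qed.

Definition uncolored_degree x w : R := #|star es (uncolored w) x|%:R.
(** Negated so that the upper tail bound controls a shortage of colors. *)
Definition minus_kept e w : R := - #|kept w e|%:R.

(** Edges at [x] that become colored when the labels of [c] change all take [c], and at most one
    edge at [x] does so. *)
Lemma uncolored_degree_lipschitz x : lipschitz (uncolored_degree x).
Proof.
move=> w c a b; rewrite /uncolored_degree.
pose S := [set f in star es (uncolored (upd w c a)) x | takes (upd w c b) c f].
have cS : (#|S| <= 1)%N.
  have SP f : f \in S -> x \in es f /\ takes (upd w c b) c f.
    by rewrite in_set => /andP[/[1!in_set] /andP[_ ->] ->].
  apply/card_le1_eqP => f g /SP[xf tf] /SP[xg tg].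
  exact: takes_star tg tf xg xf.
suff : (#|star es (uncolored (upd w c a)) x| <= #|star es (uncolored (upd w c b)) x| + 1)%N.
  by rewrite -(ler_nat R) natrD; lra.
apply: leq_trans (leq_add (leqnn _) cS); apply: leq_trans (leq_card_setU _ _).
apply/subset_leq_card/subsetP => f fx; rewrite inE.
case: (boolP (takes (upd w c b) c f)) => tf.
  by apply/orP; right; rewrite inE fx tf.
apply/orP; left; move: fx; rewrite !inE => /andP[/andP[-> /forall_inP un] ->] /=.
rewrite andbT; apply/forall_inP => c' c'L.
have [->//|cc'] := eqVneq c' c.
by have := un c' c'L; rewrite /takes !ffunE (negbTE cc').
Qed.

Lemma minus_kept_lipschitz e : lipschitz (minus_kept e).
Proof.
move=> w c a b; rewrite /minus_kept.
suff : (#|kept (upd w c b) e| <= #|kept (upd w c a) e| + 1)%N.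
  by rewrite -(ler_nat R) natrD; lra.
rewrite -(cards1 c); apply: leq_trans (leq_card_setU _ _).
apply/subset_leq_card/subsetP => c' c'k; rewrite in_setU in_set1.
have [//|cc'] := eqVneq c' c; first by rewrite orbT.
rewrite orbF; move: c'k; rewrite !inE => /andP[-> /forall_inP un] /=.
apply/forall_inP => f fn; have := un f fn.
by rewrite /takes !ffunE (negbTE cc').
Qed.

Lemma mean_takes c f : f \in color_graph c ->
  mean (fun z : label => (~~ selected es (color_graph c) z f)%:R : R) <= 1 - rate.
Proof.
move=> fc; rewrite mean_indicator.
have := selected_ge (@nonempty_graph c) (@nbhd_graph c) eta01 M_large T_gt0 fc.
have -> : #|[set z : label | ~~ selected es (color_graph c) z f]|%:R =
    #|{: label}|%:R - #|[set z : label | selected es (color_graph c) z f]|%:R :> R.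
  rewrite -(cardsC [set z : label | selected es (color_graph c) z f]) natrD addrC addKr.
  by congr _%:R; apply: eq_card => z; rewrite !inE.
move=> h; rewrite mulrBl divff ?gt_eqF // lerB // ler_pdivlMr //.
by rewrite /rate mulrAC ler_pdivrMr // [leRHS]mulrC.
Qed.

(** Colors are independent, so an edge takes none of its at least [l] colors with probability at
    most [(1 - rate) ^+ l]. *)
Lemma mean_uncolored_degree x :
  mean (uncolored_degree x) <= D%:R * (1 - rate) ^+ l.
Proof.
have /andP[r0 r1] : 0 <= 1 - rate <= 1.
  by rewrite subr_ge0 rate_le1 gerBl rate_ge0.
have -> : mean (uncolored_degree x) = \sum_(f in star es A x)
    mean (fun w => \prod_(c in L f) (~~ takes w c f)%:R : R).
  rewrite -mean_sum; congr (_ / _); apply: eq_bigr => w _.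
  rewrite /uncolored_degree -sum1_card natr_sum big_mkcond [RHS]big_mkcond /=.
  apply: eq_bigr => f _; rewrite !inE; case: (f \in A) => //=.
  case: (x \in es f); rewrite ?andbF // andbT.
  case: forall_inP => [un|nun].
    by rewrite big1 // => c cL; rewrite un.
  have [c cL tc] : exists2 c, c \in L f & takes w c f.
    have [/exists_inP//|] := boolP [exists c in L f, takes w c f].
    by rewrite negb_exists_in => /forall_inP.
  by rewrite (bigD1 c cL) /= tc mul0r.
apply: (@le_trans _ _ (\sum_(f in star es A x) (1 - rate) ^+ l)); last first.
  by rewrite sumr_const -[leLHS]mulr_natl ler_wpM2r ?exprn_ge0 // ler_nat.
apply: ler_sum => f; rewrite inE => /andP[fA _].
pose g c (z : label) : R :=
  if c \in L f then (~~ selected es (color_graph c) z f)%:R else 1.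
have -> : mean (fun w => \prod_(c in L f) (~~ takes w c f)%:R : R) =
    mean (fun w => \prod_c g c (w c)).
  by congr (_ / _); apply: eq_bigr => w _; rewrite big_mkcond.
rewrite mean_prod (bigID (mem (L f))) /= [X in _ * X]big1 ?mulr1; last first.
  by move=> c cL; rewrite /g (negbTE cL); apply: mean_cst; apply: label_gt0.
apply: (@le_trans _ _ (\prod_(c in L f) (1 - rate))).
  apply: ler_prod => c cL; rewrite /g cL; apply/andP; split.
    by rewrite divr_ge0 // sumr_ge0.
  by apply: mean_takes; rewrite inE fA.
by rewrite prodr_const ler_wiXn2l // L_ge.
Qed.

Lemma mean_minus_kept e : e \in A ->
  mean (minus_kept e) <= - (l%:R * ((1 - eta) * gain k%:R)).
Proof.
move=> eA; rewrite /minus_kept meanN lerN2.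
have -> : mean (fun w => #|kept w e|%:R) = \sum_(c in L e)
    mean (fun w => [forall f in closed_nbhd es (color_graph c) e, ~~ takes w c f]%:R : R).
  rewrite -mean_sum; congr (_ / _); apply: eq_bigr => w _.
  rewrite -sum1_card natr_sum big_mkcond [RHS]big_mkcond /=.
  by apply: eq_bigr => c _; rewrite !inE; case: (c \in L e); case: [forall _ in _, _].
have g0 : 0 <= (1 - eta) * gain k%:R.
  by rewrite mulr_ge0 ?gain_ge0 ?ler_nat //; have := eta01; lra.
apply: (@le_trans _ _ (\sum_(c in L e) ((1 - eta) * gain k%:R))).
  by rewrite sumr_const -[leRHS]mulr_natl ler_wpM2r // ler_nat L_ge.
apply: ler_sum => c cL.
rewrite (mean_marginal c (fun z => [forall f in closed_nbhd es (color_graph c) e,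
  ~~ selected es (color_graph c) z f]%:R)) ?label_gt0 // mean_indicator.
rewrite ler_pdivlMr //.
apply: (unhit_ge (@nonempty_graph c) (@nbhd_graph c) eta01 M_large T_gt0 _ k_ge2
   (@unif_graph c) (@star_graph c)) => //.
by rewrite inE eA.
Qed.

(* The labels deciding whether [e] is [bad] belong to edges of [near e]. *)
Definition near e : {set E} := \bigcup_(f in closed_nbhd es A e) closed_nbhd es A f.

Let nonempty f : f \in A -> (0 < #|es f|)%N.
Proof. by move/unif->; lia. Qed.

Lemma nearC e f : e \in A -> f \in A -> (f \in near e) = (e \in near f).
Proof.
suff sym e' f' : e' \in A -> f' \in near e' -> e' \in near f'.
  by move=> eA fA; apply/idP/idP; apply: sym.
move=> e'A /bigcupP[g]; rewrite inE => /andP[gA eg]; rewrite inE => /andP[fA gf].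
by apply/bigcupP; exists g; rewrite inE ?gA ?e'A meetsC.
Qed.

Lemma card_near e : e \in A -> (#|near e| <= T ^ 2)%N.
Proof.
move=> eA; apply: leq_trans (card_bigcup_le _ _) _.
apply: (@leq_trans (\sum_(f in closed_nbhd es A e) T)).
  by apply: leq_sum => f; rewrite inE => /andP[fA _]; apply: card_closed_nbhd.
by rewrite sum_nat_const expnS expn1 leq_mul2r card_closed_nbhd ?orbT.
Qed.

Lemma takes_local w w' c f :
    (forall a, a.1 \in closed_nbhd es A f -> w c a = w' c a) ->
  takes w c f = takes w' c f.
Proof.
move=> eqw; rewrite /takes /selected; case fc : (f \in _) => //=.
have fA := sub_graph fc.
have sub (b : index) : b \in rivals es (color_graph c) T f -> b.1 \in closed_nbhd es A f.
  rewrite inE; case: b => g [j|] /=; last by rewrite !inE => /andP[/andP[-> _] ->].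
  by case/andP => /eqP-> _; apply: nbhd_refl nonempty _ fA.
have e0 : w c (f, None) = w' c (f, None).
  by apply: eqw; apply: sub; apply: rivals_refl (@nonempty_graph c) _ fc.
by apply/strict_minP/strict_minP => h b bR bf; have := h b bR bf;
  rewrite e0 eqw // sub.
Qed.

Variable t : R.
Hypothesis t01 : 0 <= t <= 1.
Hypothesis rare_bad :
  4 * T%:R ^+ 4 * (k%:R + 1) * expR (- (t ^+ 2 * #|K|%:R / 8)) <= 1.

Let degree_bound : R := D%:R * (1 - rate) ^+ l + t * #|K|%:R.
Let kept_bound : R := - (l%:R * ((1 - eta) * gain k%:R)) + t * #|K|%:R.

(** The degree events at the vertices of [e] are bundled with its list event, so that the local
    lemma is indexed by edges alone. *)
Definition bad e : {set outcome} :=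
  if e \in A then
    (\bigcup_(x in es e) [set w | degree_bound < uncolored_degree x w])
      :|: [set w | kept_bound < minus_kept e w]
  else set0.

Let outcome0 : 0 < #|{: outcome}|%:R :> R.
Proof. by rewrite ltr0n card_ffun expn_gt0 label_gt0. Qed.

Lemma card_bad e : (4 * T ^ 4 * #|bad e| <= #|{: outcome}|)%N.
Proof.
rewrite /bad; case: ifP => [eA|_]; last by rewrite cards0 muln0.
rewrite -(ler_nat R) 2!natrM natrX; have := rare_bad; set p := expR _ => rare_p.
have p0 : 0 <= p by apply: expR_ge0.
have hx x : #|[set w | degree_bound < uncolored_degree x w]|%:R <= p * #|{: outcome}|%:R :> R.
  exact: (lipschitz_tail label_gt0 t01 (uncolored_degree_lipschitz x)
    (mean_uncolored_degree x)).
have he : #|[set w | kept_bound < minus_kept e w]|%:R <= p * #|{: outcome}|%:R :> R.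
  exact: (lipschitz_tail label_gt0 t01 (minus_kept_lipschitz e)
    (mean_minus_kept eA)).
have : (#|(\bigcup_(x in es e) [set w | (degree_bound < uncolored_degree x w)%R])
    :|: [set w | (kept_bound < minus_kept e w)%R]|)%:R <= (k%:R + 1) * p * #|{: outcome}|%:R :> R.
  apply: (@le_trans _ _ (\sum_(x in es e)
      #|[set w | (degree_bound < uncolored_degree x w)%R]|%:R
      + #|[set w | (kept_bound < minus_kept e w)%R]|%:R)).
    rewrite -natr_sum -natrD ler_nat; apply: leq_trans (leq_card_setU _ _) _.
    by rewrite leq_add2r; apply: card_bigcup_le.
  rewrite -mulrA [leRHS]mulrDl mul1r lerD // -(unif eA) mulr_natl -sumr_const.
  exact: ler_sum.
set b := #|_|%:R; move: outcome0; set N := #|_|%:R => N0 hb.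
apply: (@le_trans _ _ (4 * T%:R ^+ 4 * ((k%:R + 1) * p * N))).
  by rewrite ler_wpM2l // mulr_ge0 // exprn_ge0.
rewrite (_ : _ * _ = 4 * T%:R ^+ 4 * (k%:R + 1) * p * N); last by ring.
by rewrite -[leRHS]mul1r ler_wpM2r // ltW.
Qed.

Lemma bad_local e w w' :
    (forall c a, a.1 \in near e -> w c a = w' c a) ->
  (w \in bad e) = (w' \in bad e).
Proof.
move=> eqw; rewrite /bad; case: ifP => [eA|_]; last by rewrite !inE.
have eqt c f : f \in closed_nbhd es A e -> takes w c f = takes w' c f.
  by move=> fe; apply: takes_local => a af; apply: eqw; apply/bigcupP; exists f.
have eqd x : x \in es e -> uncolored_degree x w = uncolored_degree x w'.
  move=> xe; rewrite /uncolored_degree; congr _%:R; apply: eq_card => f.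
  rewrite !inE; case fA : (f \in A) => //=; case xf : (x \in es f); rewrite ?andbF //.
  congr (_ && _); apply: eq_forallb_in => c _; rewrite eqt // inE fA.
  by apply/meets_exP; exists x.
have eqk : minus_kept e w = minus_kept e w'.
  rewrite /minus_kept; congr (- _%:R); apply: eq_card => c; rewrite !inE.
  congr (_ && _); apply: eq_forallb_in => f; rewrite inE => /andP[fc ef].
  by rewrite eqt // inE ef (sub_graph fc).
rewrite !in_setU !in_set eqk; congr (_ || _).
by apply/bigcupP/bigcupP => -[x xe]; rewrite inE => h; exists x; rewrite // inE;
   [rewrite -eqd|rewrite eqd].
Qed.

Definition splice (X : {set E}) w w' : outcome :=
  [ffun c => [ffun a => if a.1 \in X then w c a else w' c a]].

Lemma splice_in (X : {set E}) w w' c (a : index) : a.1 \in X -> splice X w w' c a = w c a.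
Proof. by move=> aX; rewrite !ffunE aX. Qed.

Lemma splice_notin (X : {set E}) w w' c (a : index) : a.1 \notin X -> splice X w w' c a = w' c a.
Proof. by move=> aX; rewrite !ffunE (negbTE aX). Qed.

Definition linked e : {set E} :=
  if e \in A then [set f in A | ~~ [disjoint near e & near f]] else set0.

Lemma card_linked e : (#|linked e| <= T ^ 4)%N.
Proof.
rewrite /linked; case: ifP => eA; last by rewrite cards0.
have sub : [set f in A | ~~ [disjoint near e & near f]] \subset \bigcup_(g in near e) near g.
  apply/subsetP => f; rewrite inE => /andP[fA /pred0Pn[g /andP[/= ge gf]]].
  apply/bigcupP; exists g => //; rewrite nearC //.
  by case/bigcupP: gf => h _; rewrite inE => /andP[].
apply: leq_trans (subset_leq_card sub) _; apply: leq_trans (card_bigcup_le _ _) _.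
apply: (@leq_trans (\sum_(g in near e) T ^ 2)).
  apply: leq_sum => g /bigcupP[h _]; rewrite inE => /andP[gA _]; exact: card_near.
by rewrite sum_nat_const (leq_trans (leq_mul (card_near eA) (leqnn _))) // -expnD.
Qed.

(** [bad e] is decided by the labels of [near e], and the events in [J] by labels outside it;
    [splice] exchanges the two groups. *)
Lemma bad_indep e (J : {set E}) : [disjoint J & linked e] ->
  (#|bad e :&: avoiding bad J| * #|{: outcome}| = #|bad e| * #|avoiding bad J|)%N.
Proof.
move=> dJ; have [eA|eA] := boolP (e \in A); last first.
  by rewrite /bad (negbTE eA) set0I cards0 !mul0n.
apply: (@mix_indep _ (splice (near e))) => [w w'|w w'|w w'].
- apply/ffunP => c; apply/ffunP => a; rewrite !ffunE.
  by case: (a.1 \in near e).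
- by apply: bad_local => c a ae; rewrite splice_in.
- rewrite /avoiding; apply/bigcapP/bigcapP => h j jJ; have := h j jJ;
  rewrite !in_setC; congr (~~ _); [|symmetry]; (have [jA|jA] := boolP (j \in A);
    last by rewrite /bad (negbTE jA) !inE).
  all: apply: bad_local => c a aj; rewrite splice_notin //.
  all: have := disjointFr dJ jJ; rewrite /linked eA inE jA /= => /negbFE djn.
  all: by rewrite (disjointFl djn aj).
Qed.

Lemma batch_outcome : exists w, forall e, w \notin bad e.
Proof.
apply: (local_lemma bad_indep card_linked card_bad); first by rewrite expn_gt0 T_gt0.
by rewrite -(ltr0n R).
Qed.

Lemma batch_coloring (c0 : K) : exists (A' : {set E}) (col : E -> K),
  [/\ A' \subset A,
      forall f, f \in A :\: A' -> col f \in L f,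
      forall f g, f \in A :\: A' -> g \in A :\: A' -> f != g -> meets es f g ->
        col f != col g,
      forall x, #|star es A' x|%:R <= degree_bound
    & forall e, e \in A' -> l%:R * ((1 - eta) * gain k%:R) - t * #|K|%:R <=
        #|[set c in L e | [forall f in A :\: A', meets es e f ==> (col f != c)]]|%:R].
Proof.
have [w wP] := batch_outcome.
(* An edge that took several colors gets one of them; the default is used only for edges that took
   none. *)
pose col f := odflt c0 [pick c in L f | takes w c f].
have colP f : f \in A :\: uncolored w -> (col f \in L f) && takes w (col f) f.
  rewrite in_setD => /andP[fu fA]; rewrite /col; case: pickP => [c //|none].
  move: fu; rewrite inE fA /= negb_forall_in => /exists_inP[c cL].
  by rewrite negbK => tc; have := none c; rewrite cL tc.
exists (uncolored w), col; split.
- by apply/subsetP => f; rewrite inE => /andP[].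
- by move=> f /colP/andP[].
- move=> f g /colP/andP[_ tf] /colP/andP[_ tg] fg; apply: contraTneq => cfg.
  by apply: takes_disjoint fg tf _; rewrite cfg.
(* No event speaks about a vertex on no uncolored edge, but there the bound holds trivially. *)
- move=> x; have [s0|/set0Pn[e]] := eqVneq (star es (uncolored w) x) set0.
    rewrite s0 cards0 addr_ge0 ?mulr_ge0 ?exprn_ge0 ?subr_ge0 ?rate_le1 //.
    by case/andP: t01.
  rewrite in_set => /andP[eu xe]; have eA : e \in A by move: eu; rewrite inE => /andP[].
  have := wP e; rewrite /bad eA in_setU negb_or => /andP[+ _].
  rewrite leNgt; apply: contra => lt; apply/bigcupP; exists x; rewrite // inE.
  exact: lt.
- move=> e eu; have eA : e \in A by move: eu; rewrite inE => /andP[].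
  have := wP e; rewrite /bad eA in_setU negb_or => /andP[_].
  rewrite inE -leNgt /minus_kept /kept_bound => hk.
  apply: (@le_trans _ _ #|kept w e|%:R); first by lra.
  rewrite ler_nat; apply/subset_leq_card/subsetP => c; rewrite !in_set.
  case/andP => cL /forall_inP free; rewrite cL; apply/forall_inP => f fAu.
  apply/implyP => ef; have /andP[fL tf] := colP f fAu.
  apply: contraTneq tf => cfc; rewrite cfc; apply: free; rewrite inE ef andbT.
  by rewrite inE -cfc fL andbT; move: fAu; rewrite in_setD => /andP[].
Qed.
End Means.
End Batch.

(** * One batch with all error terms absorbed into [alpha] *)

Section Asymptotics.
Local Open Scope ring_scope.
Variable R : realType.

Lemma nat_above (x : R) : exists n : nat, x <= n%:R.
Proof.
exists (Num.bound x); have [x0|/ltW x0] := leP 0 x; first exact/ltW/archi_boundP.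
exact: le_trans x0 (ler0n _ _).
Qed.

(** Yields [(1 - p)^n <= 1 / (1 + n p)], later weakened to [1 - n p + (n p)^2]. *)
Lemma exprn_1B_le (p : R) n : 0 <= p <= 1 -> (1 - p) ^+ n * (1 + n%:R * p) <= 1.
Proof.
move=> /andP[p0 p1]; elim: n => [|n IH]; first by rewrite expr0 !mul1r mul0r addr0.
apply: le_trans IH; rewrite exprSr -mulrA ler_wpM2l ?exprn_ge0 ?subr_ge0 //.
have n0 : 0 <= n%:R :> R by rewrite ler0n.
by rewrite -natr1; nra.
Qed.

(** The degree-five term of the exponential series already beats the fourth power. *)
Lemma expR_beats_pow4 (a s : R) : 0 < s ->
  exists m0 : nat, forall m : nat, (m0 <= m)%N ->
    a * m%:R ^+ 4 * expR (- (s * m%:R)) <= 1.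
Proof.
move=> s0; have [m0 m0P] := nat_above (a * 5`!%:R / s ^+ 5).
exists m0 => m lem; rewrite expRN ler_pdivrMr ?expR_gt0 // mul1r.
have sm : 0 <= s * m%:R by rewrite mulr_ge0 // ltW.
apply: le_trans (expR_ge1Dxn 4 sm).
apply: (@le_trans _ _ ((s * m%:R) ^+ 5 / 5`!%:R)); last by rewrite lerDr.
have f0 : 0 < 5`!%:R :> R by rewrite ltr0n fact_gt0.
rewrite ler_pdivlMr // exprMn [m%:R ^+ 5]exprS.
have : a * 5`!%:R <= m%:R * s ^+ 5.
  rewrite -ler_pdivrMr ?exprn_gt0 //; apply: le_trans m0P _.
  by rewrite ler_nat.
have : 0 <= m%:R ^+ 4 :> R by rewrite exprn_ge0.
move=> x0 le.
by rewrite [leLHS]mulrAC [leRHS]mulrA [s ^+ 5 * _]mulrC ler_wpM2r.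
Qed.

Lemma batch_step (k : nat) (alpha c : R) : (2 <= k)%N ->
    0 < alpha < 1 -> 0 < c <= 1 ->
  exists m0 : nat, forall (V E K : finType) (es : E -> {set V}) (D l : nat)
    (A : {set E}) (L : E -> {set K}),
  (0 < #|K|)%N -> (m0 <= #|K|)%N -> (0 < D)%N ->
  (forall f, f \in A -> #|es f| = k) ->
  (forall v, (#|star es A v| <= D)%N) ->
  (forall f, f \in A -> (l <= #|L f|)%N) ->
  c * #|K|%:R <= l%:R -> l%:R <= alpha / 2 * (k * D)%:R -> 
  c * (k * D)%:R <= #|K|%:R ->
  exists (A' : {set E}) (col : E -> K),
  [/\ A' \subset A,
      forall f, f \in A :\: A' -> col f \in L f,
      forall f g, f \in A :\: A' -> g \in A :\: A' -> f != g -> meets es f g ->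
        col f != col g,
      forall x, (k * #|star es A' x|)%:R <= (k * D)%:R - (1 - alpha) * l%:R
    & forall e, e \in A' -> (gain k%:R - alpha) * l%:R <=
        #|[set c in L e | [forall f in A :\: A', meets es e f ==> (col f != c)]]|%:R].
Proof.
move=> k2 /andP[al0 al1] /andP[c0 c1].
have K2 : 2 <= k%:R :> R by rewrite ler_nat.
(* The degree bound loses [alpha / 4] to [eta], [alpha / 2] to the quadratic term through [lT], and
   [alpha / 4] to the deviation [t], each times [l]. *)
pose eta := alpha / 4; pose t := alpha * c / (4 * k%:R).
have t0 : 0 < t by rewrite divr_gt0 ?mulr_gt0 //; lra.
have t1 : t <= 1.
  have : alpha * c <= 1 by rewrite mulr_ile1 // ltW.
  by rewrite /t ler_pdivrMr; [lra|rewrite mulr_gt0 //; lra].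
have eta01 : 0 < eta < 1 by rewrite /eta; lra.
have s0 : 0 < t ^+ 2 / 8 by rewrite divr_gt0 ?exprn_gt0.
have [m0 m0P] := expR_beats_pow4 (4 * (k%:R + 1) / c ^+ 4) s0.
exists m0 => V E K es D l A L K0 Km D0 unif starD Ll cl lT cT.
set T := (k * D)%N in lT cT *.
have T0 : 0 < T%:R :> R by rewrite ltr0n muln_gt0 D0 (ltnW k2).
have [M MP] := nat_above (36 * T%:R ^+ 3 / eta).
have M_large : 36 * T%:R ^+ 3 <= eta * M%:R.
  by rewrite [leRHS]mulrC -ler_pdivrMr //; case/andP: eta01.
(* Since [T <= #|K| / c], the polynomial factor is bounded in terms of the batch size. *)
have rare : 4 * T%:R ^+ 4 * (k%:R + 1) * expR (- (t ^+ 2 * #|K|%:R / 8)) <= 1.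
  apply: le_trans (m0P _ Km); rewrite [t ^+ 2 * _ / 8]mulrAC.
  rewrite ler_wpM2r ?expR_ge0 //.
  rewrite (_ : _ / _ * _ = 4 * (#|K|%:R / c) ^+ 4 * (k%:R + 1)); last first.
    by field; rewrite gt_eqF.
  rewrite ler_wpM2r //; first by lra.
  rewrite ler_wpM2l // ler_pXn2r ?nnegrE ?divr_ge0 ?ler0n ?(ltW c0) //.
  by rewrite ler_pdivlMr // mulrC.
have t01 : 0 <= t <= 1 by rewrite ltW.
have [w0 _] := card_gt0P K0.
have [A' [col [sA colL colP deg kept]]] :=
  batch_coloring k2 D0 unif starD Ll eta01 M_large t01 rare w0.
exists A', col; split=> // [x|e eA'].
  rewrite natrM; have := deg x; rewrite -/T; set p := (1 - eta) / T%:R => degx.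
  have p01 : 0 <= p <= 1.
    have [e0 e1] := andP eta01; have : 1 <= T%:R :> R by rewrite ler1n -(ltr0n R).
    by rewrite divr_ge0 ?ler_pdivrMr //=; lra.
  have z0 : 0 <= l%:R * p by rewrite mulr_ge0 //; case/andP: p01.
  have powle : (1 - p) ^+ l <= 1 - l%:R * p + (l%:R * p) ^+ 2.
    have := exprn_1B_le l p01; move: (l%:R * p) z0 => z z0.
    have : 0 <= (1 - p) ^+ l by rewrite exprn_ge0 // subr_ge0; case/andP: p01.
    move: ((1 - p) ^+ l) => q q0 qz.
    rewrite -(@ler_pM2r _ (1 + z)); last by lra.
    have : 0 <= z ^+ 3 by rewrite exprn_ge0.
    lra.
  have kt : k%:R * (t * #|K|%:R) <= alpha / 4 * l%:R.
    rewrite (_ : _ * _ = alpha / 4 * (c * #|K|%:R)).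
      by rewrite ler_wpM2l //; lra.
    by rewrite /t; field; rewrite gt_eqF //; lra.
  have Tp : T%:R * p = 1 - eta by rewrite mulrC divfK ?gt_eqF.
  apply: (@le_trans _ _ (k%:R * (D%:R * (1 - l%:R * p + (l%:R * p) ^+ 2)
     + t * #|K|%:R))); last first.
    rewrite mulrDr mulrA -natrM -/T.
    rewrite (_ : T%:R * _ = T%:R - l%:R * (T%:R * p)
      + l%:R * (T%:R * p) * (l%:R * (T%:R * p)) / T%:R); last first.
      by field; rewrite gt_eqF.
    rewrite Tp.
    have : l%:R * (1 - eta) * (l%:R * (1 - eta)) / T%:R <= l%:R * (alpha / 2).
      rewrite ler_pdivrMr // -[leRHS]mulrA.
      have l1 : l%:R * (1 - eta) <= l%:R by rewrite ler_piMr // /eta; lra.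
      have l2 : 0 <= l%:R * (1 - eta) by rewrite mulr_ge0 // /eta; lra.
      by apply: ler_pM => //; apply: le_trans lT.
    by rewrite /eta; lra.
  by rewrite ler_wpM2l //; apply: (le_trans degx); rewrite lerD2r ler_wpM2l.
apply: le_trans (kept e eA').
have g1 : 0 <= gain (k%:R : R) <= 1.
  rewrite gain_ge0 //= /gain ler_pdivrMr; nra.
have tm : t * #|K|%:R <= alpha / 4 * l%:R.
  rewrite (_ : _ * _ = alpha / 4 * (c * #|K|%:R) / k%:R).
    rewrite ler_pdivrMr; last by lra.
    have : alpha / 4 * (c * #|K|%:R) <= alpha / 4 * l%:R by rewrite ler_wpM2l //; lra.
    have : 0 <= alpha / 4 * l%:R by rewrite mulr_ge0 //; lra.
    by nra.
  by rewrite /t; field; rewrite gt_eqF //; lra.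
have l0 : 0 <= l%:R :> R by [].
have : l%:R * (eta * gain k%:R) <= l%:R * eta.
  by rewrite ler_wpM2l // ler_piMr //; [rewrite /eta; lra | case/andP: g1].
have : 0 <= l%:R * alpha by rewrite mulr_ge0 // ltW.
by rewrite /eta in tm *; lra.
Qed.
End Asymptotics.

(** * List coloring: gluing partial colorings, and the greedy bound *)

Section ListColoring.
Variables (V E K : finType) (es : E -> {set V}).
Implicit Types (A : {set E}) (L : E -> {set K}).

Definition list_colorable A L := exists col : E -> K,
  (forall f, f \in A -> col f \in L f) /\
  (forall f g, f \in A -> g \in A -> f != g -> meets es f g -> col f != col g).

Lemma list_colorable0 L (c0 : K) : list_colorable set0 L.
Proof. by exists (fun=> c0); split=> f; rewrite inE. Qed.

Lemma list_colorable_extend A A' L (col : E -> K) : A' \subset A ->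
    (forall f, f \in A :\: A' -> col f \in L f) ->
    (forall f g, f \in A :\: A' -> g \in A :\: A' -> f != g -> meets es f g ->
      col f != col g) ->
    list_colorable A' (fun e =>
      [set c in L e | [forall f in A :\: A', meets es e f ==> (col f != c)]]) ->
  list_colorable A L.
Proof.
move=> sA colL colP [col' [col'L col'P]].
have inD f : f \in A -> f \notin A' -> f \in A :\: A' by move=> fA fA'; rewrite inE fA'.
have mixed f g : f \in A' -> g \in A :\: A' -> meets es f g -> col' f != col g.
  move=> fA' gD mfg; have := col'L f fA'; rewrite inE => /andP[_ /forall_inP h].
  by have := h g gD; rewrite mfg eq_sym.
exists (fun f => if f \in A' then col' f else col f); split=> [f fA|f g fA gA fg mfg].
  case: ifPn => fA'; last by apply/colL/inD.
  by have := col'L f fA'; rewrite inE => /andP[].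
case: ifPn => fA'; case: ifPn => gA'.
- exact: col'P.
- by apply: mixed mfg => //; apply: inD.
- by rewrite eq_sym; apply: mixed; rewrite 1?meetsC //; apply: inD.
- by apply: colP mfg => //; apply: inD.
Qed.

Lemma greedy_list_coloring A L k D (c0 : K) :
    (0 < k)%N -> (forall f, f \in A -> #|es f| = k) ->
    (forall v, #|star es A v| <= D) -> (forall f, f \in A -> k * D <= #|L f|) ->
  list_colorable A L.
Proof.
move=> k0 unif starD LkD.
have [n] := ubnP #|A|; elim: n => // n IH in A unif starD LkD *; rewrite ltnS => leAn.
have [->|/set0Pn[e eA]] := eqVneq A set0; first exact: list_colorable0.
have DA f : f \in A :\ e -> f \in A by rewrite inE => /andP[].
have ltA : #|A :\ e| < n by move: leAn; rewrite (cardsD1 e) eA.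
have starD' v : #|star es (A :\ e) v| <= D.
  apply: leq_trans (starD v); apply/subset_leq_card/subsetP => f.
  by rewrite !inE => /andP[/andP[_ ->] ->].
have [col [colL colP]] := IH (A :\ e) (fun f fA => unif f (DA f fA)) starD'
  (fun f fA => LkD f (DA f fA)) ltA.
have [c cL cfree] : exists2 c, c \in L e &
    forall f, f \in A :\ e -> meets es e f -> col f != c.
  (* The closed neighborhood counts [e] itself, so at most [k * D - 1] colors are blocked. *)
  pose N := closed_nbhd es A e :\ e.
  have ltN : #|col @: N| < #|L e|.
    apply: leq_ltn_trans (leq_imset_card _ _) _.
    have := card_closed_nbhd unif starD eA.
    have eN : e \in closed_nbhd es A e.
      by rewrite inE eA /meets setIid -card_gt0 unif.
    by rewrite (cardsD1 e) eN add1n => h; apply: leq_trans h (LkD e eA).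
  have /subsetPn[c cL cN] : ~~ (L e \subset col @: N).
    by apply: contraL ltN => /subset_leq_card; rewrite -leqNgt.
  exists c => // f fA ef; apply: contraNneq cN => <-; apply: imset_f.
  by rewrite in_setD1 inE ef; move: fA; rewrite in_setD1 => /andP[-> ->].
apply: (@list_colorable_extend A (A :\ e) L (fun=> c)); first exact: subsetDl.
- by move=> f; rewrite !inE negb_and negbK => /andP[/orP[/eqP->|/negbTE->]].
- move=> f g; rewrite !inE !negb_and !negbK.
  by case/andP => /orP[/eqP->|/negbTE-> //] _ /andP[/orP[/eqP->|/negbTE-> //] _]; rewrite eqxx.
exists col; split=> // f fA; rewrite inE colL //=; apply/forall_inP => g.
rewrite !inE negb_and negbK => /andP[/orP[/eqP->|/negbTE-> //] _].
by apply/implyP => mfe; rewrite eq_sym; apply: cfree; rewrite // meetsC.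
Qed.
End ListColoring.

(** * Iterating over the batches *)

Section Iteration.
Local Open Scope ring_scope.
Variables (R : realType) (V E : finType) (es : E -> {set V}).
Variables (k m B D0 : nat) (iota : R).
Let alpha : R := iota / 8.
(** The first bound makes the longest batch list at least [c * m]; the second gives
    [c * (k * D) <= m]. *)
Let c : R := Num.min (iota / 4) (2 * B%:R)^-1.

Hypothesis k_ge2 : (2 <= k)%N.
Hypothesis iota01 : 0 < iota <= 1.
Hypothesis B_large : 64 / iota ^+ 2 <= B%:R.
Hypothesis m_gt0 : (0 < m)%N.
Hypothesis m_le : B%:R * m%:R <= 2 * (k * D0)%:R :> R.
Hypothesis m_ge : (k * D0)%:R <= 2 * (B%:R * m%:R) :> R.
Hypothesis unif : forall f, #|es f| = k.
Hypothesis step : forall (D l : nat) (A : {set E}) (L : E -> {set 'I_m}),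
  (0 < D)%N -> (forall v, (#|star es A v| <= D)%N) ->
  (forall f, f \in A -> (l <= #|L f|)%N) ->
  c * m%:R <= l%:R -> l%:R <= alpha / 2 * (k * D)%:R ->
  c * (k * D)%:R <= m%:R ->
  exists (A' : {set E}) (col : E -> 'I_m),
  [/\ A' \subset A,
      forall f, f \in A :\: A' -> col f \in L f,
      forall f g, f \in A :\: A' -> g \in A :\: A' -> f != g -> meets es f g ->
        col f != col g,
      forall x, (k * #|star es A' x|)%:R <= (k * D)%:R - (1 - alpha) * l%:R
    & forall e, e \in A' -> (gain k%:R - alpha) * l%:R <=
        #|[set c in L e | [forall f in A :\: A', meets es e f ==> (col f != c)]]|%:R].

Definition part (L : {set 'I_B * 'I_m}) b : {set 'I_m} := [set j | (b, j) \in L].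

Lemma card_parts (L : {set 'I_B * 'I_m}) : #|L| = (\sum_b #|part L b|)%N.
Proof.
rewrite -sum1_card (partition_big (fun p => p.1) xpredT) //=; apply: eq_bigr => b _.
pose pair_b (j : 'I_m) := (b, j).
have pair_inj : injective pair_b by move=> i j [].
rewrite sum1_card -(card_imset (part L b) pair_inj).
apply: eq_card => -[b' j]; rewrite unfold_in /=; apply/andP/imsetP => [[+ /eqP eb]|[i]].
  by rewrite eb => bjL; exists j; rewrite ?inE.
by rewrite inE => iL [-> ->].
Qed.

(* The slack [iota / 2 * (k * D0)] keeps the lists linear in [D0], so that a
   batch of [m] colors is processed with relative error [alpha]; the slack
   [iota / 2 * (k * D)] decreases with [D] and pays for these errors. *)
Lemma iterated_list_coloring (D : nat) (A : {set E}) (L : E -> {set 'I_B * 'I_m})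
    (l : 'I_B -> nat) : (D <= D0)%N ->
    (forall v, (#|star es A v| <= D)%N) ->
    (forall e b, e \in A -> (l b <= #|part (L e) b|)%N) ->
    (1 - gain k%:R + iota / 2) * (k * D)%:R + iota / 2 * (k * D0)%:R
      <= (\sum_b l b)%:R ->
  list_colorable es A L.
Proof.
have [n] := ubnP D; elim: n => // n IH in D A L l *; rewrite ltnS => leDn.
have /andP[i0 i1] := iota01.
have K2 : 2 <= k%:R :> R by rewrite ler_nat.
have g0 := gain_ge0 K2.
have g1 : gain (k%:R : R) <= 1 / 2.
  have := gain_le K2; apply: le_trans; rewrite -mulrA ler_peMr // ler_pdivlMr //; lra.
have B0 : 0 < B%:R :> R by apply: lt_le_trans B_large; rewrite divr_gt0 ?exprn_gt0.
have b0 : 'I_B by apply: (@Ordinal B 0); rewrite -(ltr0n R).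
have j0 : 'I_m by exact: Ordinal m_gt0.
move=> leD starD lL inv.
have [->|/set0Pn[e0 e0A]] := eqVneq A set0; first exact: list_colorable0 (b0, j0).
have k0 : (0 < k)%N by exact: ltnW.
(* Lists of total length [k * D] finish greedily. Otherwise the invariant forces [k * D] above
   [iota / 2 * (k * D0)]. *)
have [greedy|] := leqP (k * D) (\sum_b l b).
  apply: (greedy_list_coloring (b0, j0) k0 (fun f _ => unif f) starD) => f fA.
  by rewrite card_parts; apply: leq_trans greedy _; apply: leq_sum => b _; apply: lL.
rewrite -(ltr_nat R) => lt_sum.
(* The batch with the largest guaranteed list is processed; by averaging it has at least a [1 / B]
   share of the total. *)
have [b /= _ bmax] := @arg_maxnP _ b0 xpredT l isT.
have sum_le : (\sum_b l b)%:R <= B%:R * (l b)%:R :> R.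
  rewrite -natrM ler_nat; apply: (@leq_trans (\sum_(b' : 'I_B) l b)).
    by apply: leq_sum => b' _; apply: bmax.
  by rewrite sum_nat_const card_ord.
have kD_ge0 : 0 <= (k * D)%:R :> R by [].
have kD0_ge0 : 0 <= (k * D0)%:R :> R by [].
have sum_ge : iota / 2 * (k * D0)%:R <= (\sum_b l b)%:R.
  by apply: le_trans inv; rewrite lerDr mulr_ge0 //; lra.
have kDle : (k * D)%:R <= (k * D0)%:R :> R by rewrite ler_nat leq_mul2l leD orbT.
have kD_gt : iota / 2 * (k * D0)%:R < (k * D)%:R by apply: le_lt_trans lt_sum.
have D_gt0 : (0 < D)%N.
  rewrite lt0n; apply/eqP => D0'; move: kD_gt; rewrite D0' muln0 ltNge mulr_ge0 //; lra.
have lm : (l b <= m)%N.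
  by apply: leq_trans (lL e0 b e0A) _; rewrite -[X in (_ <= X)%N](card_ord m) max_card.
have c0 : 0 < c by rewrite /c lt_min invr_gt0 mulr_gt0 //=; lra.
have c1 : c <= iota / 4 by rewrite /c ge_min lexx.
have c2 : c * (2 * B%:R) <= 1.
  by rewrite -ler_pdivlMr ?mulr_gt0 // div1r /c ge_min lexx orbT.
have cl : c * m%:R <= (l b)%:R.
  rewrite -(ler_pM2l B0) mulrCA.
  apply: (@le_trans _ _ (iota / 4 * (B%:R * m%:R))); first by rewrite ler_wpM2r ?mulr_ge0.
  apply: le_trans sum_le; apply: le_trans sum_ge.
  have : iota / 4 * (B%:R * m%:R) <= iota / 4 * (2 * (k * D0)%:R).
    by rewrite ler_wpM2l //; lra.
  lra.
(* Here [64 / iota ^+ 2 <= B] enters: it gives [m <= iota ^+ 2 / 32 * (k * D0)], which is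
   [alpha / 2] times the lower bound [kD_gt] on [k * D]. *)
have lT : (l b)%:R <= alpha / 2 * (k * D)%:R.
  have Bi : 64 <= B%:R * iota ^+ 2 by rewrite -ler_pdivrMr ?exprn_gt0.
  have lmR : (l b)%:R <= m%:R :> R by rewrite ler_nat.
  apply: le_trans lmR _; rewrite -(ler_pM2l B0); apply: le_trans m_le _.
  apply: (@le_trans _ _ (B%:R * (alpha / 2 * (iota / 2 * (k * D0)%:R)))).
    rewrite (_ : B%:R * _ = B%:R * iota ^+ 2 * ((k * D0)%:R / 32)); last first.
      by rewrite /alpha; field.
    have : 64 * ((k * D0)%:R / 32) <= B%:R * iota ^+ 2 * ((k * D0)%:R / 32).
      by rewrite ler_wpM2r // divr_ge0.
    lra.
  rewrite ler_pM2l // ler_pM2l ?ltW //; rewrite /alpha; lra.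
have cT : c * (k * D)%:R <= m%:R.
  apply: (@le_trans _ _ (c * (2 * (B%:R * m%:R)))).
    by rewrite ler_wpM2l ?(ltW c0) // (le_trans kDle).
  rewrite (_ : c * _ = c * (2 * B%:R) * m%:R); last by ring.
  by rewrite ler_piMl.
have [A' [col [sA colL colP deg kept]]] :=
  step D_gt0 starD (fun f fA => lL f b fA) cl lT cT.
apply: (@list_colorable_extend _ _ _ _ A A' L (fun f => (b, col f))) => //.
- by move=> f fD; have := colL f fD; rewrite inE.
- move=> f g fD gD fg mfg; rewrite xpair_eqE eqxx /=; exact: colP.
set L' := fun e => _.
have [->|/set0Pn[e1 e1A']] := eqVneq A' set0; first exact: list_colorable0 (b0, j0).
pose kp e := #|part (L' e) b|.
have [e2 /= e2A' e2min] := arg_minnP kp e1A'.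
have partb e : part (L' e) b =
    [set c in part (L e) b | [forall f in A :\: A', meets es e f ==> (col f != c)]].
  apply/setP => j; rewrite !inE; congr (_ && _); apply: eq_forallb => f.
  by rewrite xpair_eqE eqxx.
have kp2 : (gain k%:R - alpha) * (l b)%:R <= (kp e2)%:R.
  by rewrite /kp partb; apply: kept.
(* The batch stays in play with its surviving colors; its new guarantee is the least surviving
   number over [A']. *)
pose l' b' := if b' == b then kp e2 else l b'.
pose D' := \max_x #|star es A' x|.
have kD' : (k * D')%:R <= (k * D)%:R - (1 - alpha) * (l b)%:R.
  have lT' : (l b)%:R <= (k * D)%:R :> R.
    by apply: le_trans lT _; rewrite ler_piMl // /alpha; lra.
  rewrite /D'; elim/big_ind: _ => [|x y hx hy|x _]; last exact: deg.
    rewrite muln0; have : (1 - alpha) * (l b)%:R <= (l b)%:R by rewrite ler_piMl // /alpha; lra.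
    lra.
  by rewrite /maxn; case: ifP.
have l_gt0 : 0 < (l b)%:R :> R.
  by apply: lt_le_trans cl; rewrite mulr_gt0 // ltr0n.
have ltD' : (D' < D)%N.
  rewrite -(ltn_pmul2l k0) -(ltr_nat R); apply: le_lt_trans kD' _.
  rewrite ltrBlDr ltrDl mulr_gt0 // /alpha; lra.
apply: (IH D' A' L' l').
- exact: leq_trans ltD' leDn.
- exact: leq_trans (ltnW ltD') leD.
- by move=> v; apply: (@leq_bigmax _ (fun x => #|star es A' x|)).
- move=> e b' eA'; rewrite /l'; case: eqP => [->|/eqP ne]; first exact: e2min.
  have -> : part (L' e) b' = part (L e) b'.
    apply/setP => j; rewrite !inE andb_idr // => _; apply/forall_inP => f _.
    by apply/implyP => _; rewrite xpair_eqE eq_sym (negbTE ne).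
  by apply: lL; apply: (subsetP sA).
have -> : (\sum_b' l' b')%:R = (\sum_b' l b')%:R - (l b)%:R + (kp e2)%:R :> R.
  rewrite (bigD1 b) //= [in RHS](bigD1 b) //= /l' eqxx !natrD.
  rewrite (eq_bigr l); last by move=> b' /negbTE->.
  ring.
have coef : 0 <= 1 - gain k%:R + iota / 2 by lra.
have := ler_wpM2l coef kD'.
(* The left side bounds the fall of the total list length. The right side is at most the fall of the
   required length, so the invariant persists. *)
have : (1 - gain k%:R + alpha) * (l b)%:R <=
    (1 - gain k%:R + iota / 2) * ((1 - alpha) * (l b)%:R).
  rewrite mulrA ler_wpM2r // /alpha.
  have : 0 <= iota * gain k%:R by rewrite mulr_ge0 // ltW.
  have : iota * iota <= iota by rewrite ler_piMl // ltW.
  lra.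
lra.
Qed.
End Iteration.

(** * Choice of the palette and comparison with the stated constant *)

Section Main.
Local Open Scope ring_scope.
Variable R : realType.

(** The difference has the sign of [(k - 1) (k - 2)] times [2 k^2 + k - 2 - 3 k s] with [s] the root
    of [k]. The last factor is negative for [k = 1, 2], where the product vanishes anyway, and
    positive from [k = 3] on. *)
Lemma gain_ge (k : nat) : (0 < k)%N ->
  (k%:R - 1) / (2 * k%:R ^+ 2)
    - (k%:R - 1) * (k%:R - 2) / (6 * k%:R ^+ 3 * Num.sqrt k%:R)
  <= gain k%:R :> R.
Proof.
move=> k_gt0; set s := Num.sqrt _.
have k0 : 0 < k%:R :> R by rewrite ltr0n.
have k1 : 1 <= k%:R :> R by rewrite ler1n.
have s2 : s ^+ 2 = k%:R by rewrite sqr_sqrtr // ltW.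
have s0 : 0 < s by rewrite sqrtr_gt0.
have s1 : 1 <= s by rewrite leNgt; apply/negP => lt; nra.
have d0 : 0 < 2 * k%:R ^+ 2 + k%:R - 2 :> R by nra.
rewrite -subr_ge0 (_ : _ - _ = (k%:R - 1) * (k%:R - 2)
   * (2 * k%:R ^+ 2 + k%:R - 2 - 3 * (s * k%:R))
   / (6 * k%:R ^+ 2 * (s * k%:R) * (2 * k%:R ^+ 2 + k%:R - 2))); last first.
  rewrite /gain; field; rewrite !gt_eqF //.
apply: divr_ge0; last first.
  by rewrite ltW // !mulr_gt0 ?exprn_gt0.
have [->|k1'] := eqVneq k 1%N; first by rewrite subrr !mul0r.
have [->|k2'] := eqVneq k 2%N; first by rewrite subrr mulr0 mul0r.
have k3 : 3 <= k%:R :> R by rewrite ler_nat; move: k_gt0 k1' k2'; clear; lia.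
apply: mulr_ge0; first by rewrite mulr_ge0 //; lra.
rewrite -s2 in k3 *.
have : 17 / 10 <= s.
  rewrite leNgt; apply/negP => lt; have : s ^+ 2 < 3; last by lra.
  nra.
nra.
Qed.

Lemma chromatic_index_le (H : hypergraph) (K : finType) :
  list_colorable (@edge_set H) setT (fun=> [set: K]) -> (chromatic_index H <= #|K|)%N.
Proof.
case=> col [_ colP]; rewrite /chromatic_index; case: ex_minnP => n _; apply.
apply/existsP; exists [ffun e => enum_rank (col e)].
apply/forallP => e; apply/forallP => f; apply/implyP => /andP[ef mef].
by rewrite !ffunE (inj_eq enum_rank_inj) colP ?inE.
Qed.

Lemma star_max_degree (H : hypergraph) v :
  (#|star (@edge_set H) setT v| <= max_degree H)%N.
Proof.
apply: leq_trans (@leq_bigmax _ (@degree H) v); apply/subset_leq_card/subsetP => e.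
by rewrite !inE.
Qed.

(** The case [k = 1] is greedy; the extra color keeps the palette nonempty. *)
Lemma chromatic_index_uniform1 (H : hypergraph) : uniform_hypergraph 1 H ->
  (chromatic_index H <= (max_degree H).+1)%N.
Proof.
move=> unif; rewrite -[X in (_ <= X)%N]card_ord; apply: chromatic_index_le.
apply: (@greedy_list_coloring _ _ _ _ _ _ 1 (max_degree H) ord0) => // [v|f _].
  exact: star_max_degree.
by rewrite mul1n cardsT card_ord.
Qed.

Lemma chromatic_index_asymptotic (k : nat) (i : R) : (2 <= k)%N -> 0 < i <= 1 / 2 ->
  exists N0 : nat, forall (H : hypergraph) (D : nat), (N0 <= D)%N ->
    uniform_hypergraph k H -> (max_degree H <= D)%N ->
  (chromatic_index H)%:R <= (1 - gain k%:R + 2 * i) * (k * D)%:R.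
Proof.
move=> k2 /andP[i0 i1].
have K2 : 2 <= k%:R :> R by rewrite ler_nat.
have g0 := gain_ge0 K2.
have g1 : gain (k%:R : R) <= 1 / 2.
  have := gain_le K2; apply: le_trans; rewrite -mulrA ler_peMr // ler_pdivlMr //; lra.
have [B BP] := nat_above (64 / i ^+ 2).
have B0 : 0 < B%:R :> R by apply: lt_le_trans BP; rewrite divr_gt0 ?exprn_gt0.
pose c : R := Num.min (i / 4) (2 * B%:R)^-1.
have c01 : 0 < c <= 1.
  apply/andP; split; rewrite /c; last by rewrite ge_min; apply/orP; left; lra.
  by rewrite lt_min; apply/andP; split; [lra | rewrite invr_gt0 mulr_gt0].
have al01 : 0 < i / 8 < 1 by lra.
have [m0 stepP] := batch_step k2 al01 c01.
(* The first summand makes the rounding loss [B] at most [i * (k * D)], the second forces [m] above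
   [m0]. *)
have [N0 N0P] := nat_above (B%:R / i + 2 * (B%:R * (m0%:R + 1))).
exists N0 => H D leD unif maxD.
have N0D : N0%:R <= (k * D)%:R :> R by rewrite ler_nat (leq_trans leD) // leq_pmull // ltnW.
have Bi : B%:R <= i * (k * D)%:R.
  rewrite [leRHS]mulrC -ler_pdivrMr //; apply: le_trans N0D; apply: le_trans N0P.
  by rewrite lerDl !mulr_ge0 // addr_ge0.
have Bm0 : 2 * (B%:R * (m0%:R + 1)) <= (k * D)%:R :> R.
  apply: le_trans N0D; apply: le_trans N0P; rewrite lerDr divr_ge0 //; lra.
set T : R := (k * D)%:R in N0D Bi Bm0 *; have T0 : 0 <= T by [].
pose X := (1 - gain k%:R + 2 * i) * T / B%:R; pose m := Num.truncn X.
have X0 : 0 <= X by rewrite divr_ge0 // mulr_ge0 //; lra.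
have /andP[mX Xm] := truncn_itv X0; rewrite -/m in mX Xm.
have Bm_le : B%:R * m%:R <= (1 - gain k%:R + 2 * i) * T by rewrite mulrC -ler_pdivlMr.
have Bm_ge : (1 - gain k%:R + i) * T <= B%:R * m%:R.
  move: Xm; rewrite /X ltr_pdivrMr // -natr1; lra.
have gT : gain k%:R * T <= 1 / 2 * T by rewrite ler_wpM2r.
have iT : i * T <= 1 / 2 * T by rewrite ler_wpM2r.
have iT0 : 0 <= i * T by rewrite mulr_ge0 // ltW.
have gT0 : 0 <= gain k%:R * T by rewrite mulr_ge0.
have m0m : (m0 + 1 <= m)%N.
  rewrite -(ler_nat R) natrD -(ler_pM2l B0); lra.
have col : list_colorable (@edge_set H) setT (fun=> [set: 'I_B * 'I_m]).
  apply: (@iterated_list_coloring R _ _ (@edge_set H) k m B D i k2 _ BP _ _ _ unif _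
    D setT _ (fun=> m)) => //.
  - by rewrite i0; lra.
  - by apply: leq_trans m0m; rewrite addn1.
  - by rewrite -/T; lra.
  - by rewrite -/T; lra.
  - move=> D' l A L D'0 starA Ll cl lT cT.
    by apply: stepP; rewrite ?card_ord //; apply: leq_trans m0m; rewrite ?addn1 ?leq_addr.
  - by move=> v; apply: leq_trans (star_max_degree v) maxD.
  - move=> e b _; rewrite -[X in (X <= _)%N](card_ord m) -cardsT.
    by apply/subset_leq_card/subsetP => j; rewrite !inE.
  - by rewrite sum_nat_const card_ord natrM -/T; lra.
apply: le_trans Bm_le; rewrite -natrM ler_nat.
by apply: leq_trans (chromatic_index_le col) _; rewrite card_prod !card_ord.
Qed.
End Main.

Local Open Scope ring_scope.

Theorem theorem1p4 (R : realType) (iota : R) (iota_gt0 : 0 < iota)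
    (k : nat) (k_gt0 : (0 < k)%N) :
  exists D0 : R, forall D : R, D0 <= D ->
  forall H : hypergraph, uniform_hypergraph k H -> simple_hypergraph k H ->
    (max_degree H)%:R <= D ->
    (chromatic_index H)%:R <=
      (1 - (k%:R - 1) / (2 * k%:R ^+ 2)
         + (k%:R - 1) * (k%:R - 2) / (6 * k%:R ^+ 3 * Num.sqrt k%:R)
         + iota) * k%:R * D.
Proof.
have [k1|k_neq1] := eqVneq k 1%N.
  (* From this threshold on, the extra color fits into [iota * D]. *)
  exists iota^-1 => D leD H unif _ maxD; rewrite k1 in unif *.
  have le1 : 1 <= iota * D by rewrite mulrC -ler_pdivrMr // div1r.
  have : (chromatic_index H)%:R <= (max_degree H)%:R + 1 :> R.
    by rewrite natr1 ler_nat chromatic_index_uniform1.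
  by rewrite subrr !mul0r subr0 addr0 mulr1; lra.
have k2 : (2 <= k)%N by rewrite ltn_neqAle eq_sym k_neq1.
pose i := Num.min iota 1 / 2.
have i01 : 0 < i <= 1 / 2.
  by rewrite /i divr_gt0 ?lt_min ?iota_gt0 //= ler_pM2r ?invr_gt0 // ge_min lexx orbT.
have i_le : 2 * i <= iota.
  have : Num.min iota 1 <= iota by rewrite ge_min lexx.
  by rewrite /i; lra.
have [N0 N0P] := chromatic_index_asymptotic k2 i01.
exists N0%:R => D leD H unif _ maxD.
have ge0 : 0 <= 1 - gain k%:R + 2 * i :> R.
  have K2 : 2 <= k%:R :> R by rewrite ler_nat.
  have := gain_le K2; have := gain_ge0 K2.
  have : gain (k%:R : R) <= gain k%:R * k%:R / (k%:R - 1).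
    by rewrite -mulrA ler_peMr ?gain_ge0 // ler_pdivlMr; lra.
  by case/andP: i01; lra.
(* [D] is real, so the asymptotic bound is applied to a natural number between [max_degree H] and
   [D]. *)
pose n := maxn N0 (max_degree H).
have nD : n%:R <= D by rewrite /n /maxn; case: ifP.
have := N0P H n (leq_maxl _ _) unif (leq_maxr _ _).
move/le_trans; apply; rewrite natrM mulrA.
have D_ge0 : 0 <= D by apply: le_trans nD.
have coef_le := gain_ge R k_gt0.
apply: (@le_trans _ _ ((1 - gain k%:R + 2 * i) * k%:R * D)).
  by rewrite ler_wpM2l // mulr_ge0.
by rewrite ler_wpM2r // ler_wpM2r //; lra.
Qed.
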